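(* Let $n, r \in \mathbb{N}_0$, let $T$ be an oriented $n$-dimensional simplex with ordered vertices, and let $k \in [0:n]$. Let $\omega_{\alpha\sigma}$ be a family of complex numbers indexed over $\alpha \in A(r,n)$ and $\sigma \in \Sigma(k,n)$. Then $$\sum_{\alpha,\beta \in A(r,n)}\ \sum_{\sigma,\rho \in \Sigma(k,n)} \int_{T} \omega_{\alpha\sigma} \lambda^{\alpha}\, \mathrm{d}\lambda_{\sigma} \wedge \epsilon(\rho,\rho^{c})\, \overline{\omega_{\beta\rho}}\, \lambda^{\beta} \lambda_{\rho}\, \phi_{\rho^{c}} = (-1)^{k} \sum_{\theta \in \Sigma(k+1,n)} \int_{T} \lambda_{\theta} \Big\vert \sum_{\alpha \in A(r,n)} \sum_{p \in [\theta]} \epsilon(p,\theta-p)\, \lambda^{\alpha} \omega_{\alpha,\theta-p} \Big\vert^{2} \phi_{T}.$$ In particular, this quantity is zero if and only if one (equivalently, each) of the following equivalent conditions is satisfied: (a) $\sum_{\alpha \in A(r,n),\, \sigma \in \Sigma(k,n)} \omega_{\alpha\sigma} \lambda^{\alpha}\, \mathrm{d}\lambda_{\sigma} = 0$; (b) $\sum_{\alpha \in A(r,n),\, \sigma \in \Sigma(k,n)} \epsilon(\sigma,\sigma^c)\, \omega_{\alpha\sigma} \lambda^{\alpha} \lambda_{\sigma}\, \phi_{\sigma^c} = 0$; (c) $\omega_{\alpha\sigma} - \sum_{p \in [\sigma]} \epsilon(p,\sigma-p)\, \omega_{\alpha,\sigma-p+0} = 0$ for all $\alpha \in A(r,n)$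 and all $\sigma \in \Sigma(k,n)$ with $0 \notin [\sigma]$; (d) $\sum_{p \in [\theta]} \epsilon(p,\theta-p)\, \omega_{\alpha,\theta-p} = 0$ for all $\alpha \in A(r,n)$ and all $\theta \in \Sigma(k+1,n)$.
   Context: For integers $a,b$, $[a:b]=\{a,\dots,b\}$ (empty if $a>b$). An $n$-dimensional simplex $T$ is the convex hull of $n+1$ affinely independent points $v_0,\dots,v_n$ (its ordered vertices) in some Euclidean space. The barycentric coordinates $\lambda_0,\dots,\lambda_n$ are the affine functions on $T$ with $\lambda_i(v_j)=\delta_{ij}$, and $\mathrm{d}\lambda_i$ are their exterior derivatives (differential 1-forms on $T$); all differential forms on $T$ have complex-valued coefficients. The integral $\int_T$ of an $n$-form is taken with respect to the fixed orientation of $T$. A bar denotes complex conjugation. $A(r,n)$ is the set of maps $\alpha:[0:n]\to\mathbb{N}_0$ with $\sum_{i=0}^n\alpha(i)=r$; $\lambda^\alpha=\prod_{i=0}^n\lambda_i^{\alpha(i)}$. $\Sigma(k,n)$ is the set of strictly increasing maps $[1:k]\to[0:n]$ (with $\Sigma(0,n)=\{\emptyset\}$), and $\Sigma_0(k,n)$ is the set of strictly increasing maps $[0:k]\to[0:n]$; $[\sigma]$ denotes the image of $\sigma$. For $\sigma$ in either set, $\mathrm{d}\lambda_\sigma$ is the wedge product of the $\mathrm{d}\lambda_{\sigma(i)}$ in increasing order of $i$ and $\lambda_\sigma$ is the product of the $\lambda_{\sigma(i)}$ (both equal to $1$ for $\sigma=\emptyset$). For $p\in[\sigma]$, $\sigma-p$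 is the strictly increasing map with image $[\sigma]\setminus\{p\}$; for $q\notin[\sigma]$, $\sigma+q$ is the strictly increasing map with image $[\sigma]\cup\{q\}$; so $\sigma-p+0$ has image $([\sigma]\setminus\{p\})\cup\{0\}$. For $\sigma\in\Sigma(k,n)$, $\sigma^c\in\Sigma_0(n-k,n)$ is the strictly increasing map with image $[0:n]\setminus[\sigma]$. For $q\notin[\sigma]$, $\epsilon(q,\sigma)$ is the sign of the permutation sorting into ascending order the sequence consisting of $q$ followed by the values of $\sigma$ in order. $\epsilon(\sigma,\sigma^c)$ is the sign of the permutation sorting the values of $\sigma$ (in order) followed by the values of $\sigma^c$ (in order). For $\rho\in\Sigma_0(l,n)$ the Whitney form is $\phi_\rho=\sum_{p\in[\rho]}\epsilon(p,\rho-p)\,\lambda_p\,\mathrm{d}\lambda_{\rho-p}$, and $\phi_T:=\phi_{\rho_T}$ where $\rho_T$ is the identity map of $[0:n]$, the unique element of $\Sigma_0(n,n)$. *)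

(* Defs.v *)
From HB Require Import structures.
From mathcomp Require Import all_boot all_order all_algebra fingroup perm.
From mathcomp Require Import complex.
From mathcomp Require Import all_classical all_reals all_analysis.

Set Implicit Arguments.
Unset Strict Implicit.
Unset Printing Implicit Defensive.

Import Order.TTheory GRing.Theory Num.Theory.
Import numFieldNormedType.Exports.
Local Open Scope classical_set_scope.
Local Open Scope ring_scope.

(* Lebesgue measure on R^n, with R^n represented by the measurable type of
   n-tuples; it is the n-fold product of the one-dimensional measure. *)
Section lebesgue_tuple.
Context (R : realType).
Local Notation mR := (measurableTypeR R).

Definition tuple_cons n (p : mR * n.-tuple mR) : n.+1.-tuple mR :=
  [tuple of p.1 :: p.2].

Lemma measurable_tuple_cons n : measurable_fun setT (@tuple_cons n).
Proof. exact: (measurable_cons measurable_fst measurable_snd). Qed.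

Section cons_measure.
Context n (mu : {sigma_finite_measure set (n.-tuple mR) -> \bar R}).

Definition cons_measure : set (n.+1.-tuple mR) -> \bar R :=
  pushforward (@lebesgue_measure R \x mu)%E (@tuple_cons n).

Let nu : {measure set (n.+1.-tuple mR) -> \bar R} :=
  measure_function_pushforward__canonical__measure_function_Measure
    (@lebesgue_measure R \x mu)%E (@measurable_tuple_cons n).

Let cons_measure0 : cons_measure set0 = 0%E.
Proof. exact: (measure0 nu). Qed.

Let cons_measure_ge0 A : (0 <= cons_measure A)%E.
Proof. exact: (measure_ge0 nu). Qed.

Let cons_measure_sigma_additive : semi_sigma_additive cons_measure.
Proof. exact: (@measure_semi_sigma_additive _ _ _ nu). Qed.

HB.instance Definition _ := isMeasure.Build _ _ _ cons_measure
  cons_measure0 cons_measure_ge0 cons_measure_sigma_additive.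

Let cons_measure_sigma_finite : sigma_finite setT cons_measure.
Proof.
have /sigma_finiteP[F [TF ndF Foo]] := sigma_finiteT (@lebesgue_measure R).
have /sigma_finiteP[G [TG ndG Goo]] := sigma_finiteT mu.
pose u (t : n.+1.-tuple mR) : mR * n.-tuple mR := (thead t, [tuple of behead t]).
have uK : cancel u (@tuple_cons n) by move=> t; rewrite [t in RHS]tuple_eta.
have Ku : cancel (@tuple_cons n) u.
  by move=> [x t]; rewrite /u /tuple_cons/= theadE; congr pair; apply: val_inj.
have mu_u : measurable_fun setT u.
  apply: measurable_fun_pair; first exact: measurable_tnth.
  exact: measurable_behead.
exists (fun k => u @^-1` (F k `*` G k)).
  apply/esym; rewrite -subTset => t _.
  have [k _ Fk] : (\bigcup_k F k) (u t).1 by rewrite -TF.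
  have [l _ Gl] : (\bigcup_k G k) (u t).2 by rewrite -TG.
  exists (maxn k l) => //; split.
    by move: (u t).1 Fk; exact/subsetPset/ndF/leq_maxl.
  by move: (u t).2 Gl; exact/subsetPset/ndG/leq_maxr.
move=> k; have [mF Fk] := Foo k; have [mG Gk] := Goo k; split.
  by rewrite -[X in measurable X]setTI; apply: mu_u => //; exact: measurableX.
rewrite /cons_measure /pushforward -comp_preimage.
rewrite (_ : u \o _ = id); last by apply/funext => x; rewrite /= Ku.
by rewrite preimage_id product_measure1E// lte_mul_pinfty// ge0_fin_numE.
Qed.

HB.instance Definition _ := Measure_isSigmaFinite.Build _ _ _ cons_measure
  cons_measure_sigma_finite.

End cons_measure.

Fixpoint lebesgue_tuple n :
    {sigma_finite_measure set (n.-tuple mR) -> \bar R} :=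
  match n with
  | 0 => \d_([tuple] : 0.-tuple mR)
  | n'.+1 => cons_measure (lebesgue_tuple n')
  end.

End lebesgue_tuple.

Section multi_indices.
Implicit Types k l n r : nat.

(* The values of a multi-index of weight r are at most r, hence the finite
   codomain 'I_r.+1. *)
Definition multi_index r n : {set {ffun 'I_n.+1 -> 'I_r.+1}} :=
  [set a : {ffun 'I_n.+1 -> 'I_r.+1} | (\sum_i (a i : nat))%N == r]%SET.

(* The index set [1:k] is represented by 'I_k. Likewise [0:l] is represented by
   'I_l.+1, so that Sigma_0(l, n) is Sigma l.+1 n. *)
Definition Sigma k n : {set {ffun 'I_k -> 'I_n.+1}} :=
  [set s : {ffun 'I_k -> 'I_n.+1} |
    [forall i : 'I_k, forall j : 'I_k, (i < j)%N ==> (s i < s j)%N]]%SET.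

Definition im k n (s : {ffun 'I_k -> 'I_n.+1}) : {set 'I_n.+1} :=
  [set s i | i : 'I_k]%SET.

(* The strictly increasing map with image B, provided #|B| = k: the enumeration
   of a set of ordinals is in ascending order. *)
Definition incr k n (B : {set 'I_n.+1}) : {ffun 'I_k -> 'I_n.+1} :=
  [ffun i : 'I_k => nth ord0 (enum B) i].

(* s - p *)
Definition del k n (s : {ffun 'I_k -> 'I_n.+1}) p : {ffun 'I_k.-1 -> 'I_n.+1} :=
  incr k.-1 (im s :\ p)%SET.

(* s - p + q *)
Definition exch k n (s : {ffun 'I_k -> 'I_n.+1}) p q : {ffun 'I_k -> 'I_n.+1} :=
  incr k (q |: (im s :\ p))%SET.

(* s^c *)
Definition compl k n (s : {ffun 'I_k -> 'I_n.+1}) :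
    {ffun 'I_(n - k).+1 -> 'I_n.+1} :=
  incr (n - k).+1 (~: im s)%SET.

Definition rhoT n : {ffun 'I_n.+1 -> 'I_n.+1} := [ffun i => i].

Definition concat k l n (s : {ffun 'I_k -> 'I_n.+1})
    (t : {ffun 'I_l -> 'I_n.+1}) : {ffun 'I_(k + l) -> 'I_n.+1} :=
  [ffun i : 'I_(k + l) => match fintype.split i with inl j => s j | inr j => t j end].

(* The sign of the permutation sorting the sequence w 0, w 1, ... into ascending
   order (0 by convention if w has repetitions). *)
Definition sort_sign (C : pzRingType) k n (w : {ffun 'I_k -> 'I_n.+1}) : C :=
  if [pick pi : 'S_k | [ffun i => w (pi i)] \in Sigma k n] is Some pi
  then (-1) ^+ pi else 0.

Definition eps (C : pzRingType) k l n (s : {ffun 'I_k -> 'I_n.+1})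
  (t : {ffun 'I_l -> 'I_n.+1}) : C := sort_sign C (concat s t).

Definition eps1 (C : pzRingType) k n (q : 'I_n.+1)
  (s : {ffun 'I_k -> 'I_n.+1}) : C := eps C [ffun _ : 'I_1 => q] s.

End multi_indices.

(* A differential k-form on (a subset of) R^m assigns to a point x and to k
   tangent vectors u a complex number. *)
Definition dform (R : realType) (m k : nat) : Type :=
  'rV[R]_m -> ('I_k -> 'rV[R]_m) -> R[i].
HB.instance Definition _ (R : realType) (m k : nat) :=
  GRing.Zmodule.copy (dform R m k) ('rV[R]_m -> ('I_k -> 'rV[R]_m) -> R[i]).

Section forms.
Context (R : realType) (m : nat).
Local Notation V := 'rV[R]_m.
Local Notation C := R[i].
Local Notation dform := (dform R m).

Definition smul k (f : V -> C) (w : dform k) : dform k :=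
  fun x u => f x * w x u.

Definition cast_form k l (kl : k = l) (w : dform k) : dform l :=
  fun x u => w x (fun i => u (cast_ord kl i)).

(* The normalization for which dx1 /\ dx2 (e1, e2) = 1. *)
Definition wedge k l (w : dform k) (z : dform l) : dform (k + l) :=
  fun x u => (k`! * l`!)%N%:R^-1 *
    \sum_(s : 'S_(k + l)) (-1) ^+ s *
      w x (fun i => u (s (lshift l i))) * z x (fun j => u (s (rshift k j))).

Fixpoint wedge_all k : ('I_k -> dform 1) -> dform k :=
  match k with
  | 0 => fun _ => fun _ _ => 1
  | k'.+1 => fun w =>
      (wedge (w ord0) (wedge_all (fun i => w (lift ord0 i))) : dform k'.+1)
  end.

(* The exterior derivative of a real-valued function. *)
Definition ext_d (f : V -> R) : dform 1 := fun x u => ('D_(u ord0) f x)%:C%C.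

End forms.

Section simplex.
Context (R : realType) (m n : nat) (v : 'I_n.+1 -> 'rV[R]_m).
Local Notation V := 'rV[R]_m.
Local Notation C := R[i].

Definition edge (j : 'I_n) : V := v (lift ord0 j) - v ord0.

Definition affinely_independent : bool := row_free (\matrix_(j < n) edge j).

Definition simplex : set V := [set x | exists c : 'I_n.+1 -> R,
  [/\ forall i, 0 <= c i, \sum_i c i = 1 & x = \sum_i c i *: v i]].

Definition tangent (u : V) : Prop :=
  exists c : 'I_n -> R, u = \sum_j c j *: edge j.

Definition affine_fun (f : V -> R) : Prop :=
  forall (t : R) (x y : V), f (t *: x + (1 - t) *: y) = t * f x + (1 - t) * f y.

(* The barycentric coordinates, extended from T to affine functions on the
   ambient space. If n < m, the extension is not unique, but on T and on
   tangent vectors of T neither lam i nor its derivative depends on it. *)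
Definition barycentric (lam : 'I_n.+1 -> V -> R) : Prop :=
  (forall i, affine_fun (lam i)) /\ (forall i j, lam i (v j) = (i == j)%:R).

Lemma barycentric_exists :
  affinely_independent -> exists lam, barycentric lam.
Proof.
rewrite /affinely_independent; set E := \matrix_j _ => rfE.
pose c x : 'rV_n := (x - v ord0) *m pinvmx E.
have c0 : c (v ord0) = 0 by rewrite /c subrr mul0mx.
have cj j : c (v (lift ord0 j)) = delta_mx 0 j.
  have -> : c (v (lift ord0 j)) = row j (E *m pinvmx E).
    by rewrite row_mul /c rowK.
  by rewrite mulmxVp// row1.
have c_affine t x y : c (t *: x + (1 - t) *: y) = t *: c x + (1 - t) *: c y.
  rewrite /c !scalemxAl -mulmxDl !scalerBr addrACA -opprD -scalerDl.
  by rewrite (addrC t) subrK scale1r.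
clearbody c.
exists (fun i x => if unlift ord0 i is Some j then c x 0 j
                   else 1 - \sum_j c x 0 j); split=> [i t x y|i j].
  rewrite c_affine; case: unliftP => [j _|_]; first by rewrite !mxE.
  under eq_bigr do rewrite !mxE.
  by rewrite big_split/= -!mulr_sumr !mulrBr !mulr1 addrACA -opprD (addrC t) subrK.
case: (unliftP ord0 i) => [i' ->|->]; case: (unliftP ord0 j) => [j' ->|->].
- by rewrite cj mxE eqxx/= (inj_eq lift_inj) eq_sym.
- by rewrite c0 mxE eq_sym eq_liftF.
- rewrite cj (bigD1 j')//= big1 ?mxE ?eqxx ?addr0 ?subrr; last first.
    by move=> l lj; rewrite mxE eqxx (negbTE lj).
  by [].
- by rewrite c0 big1 ?subr0 ?eqxx// => l _; rewrite mxE.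
Qed.

Definition vanishes k (w : dform R m k) : Prop :=
  forall x, simplex x -> forall u : 'I_k -> V,
    (forall i, tangent (u i)) -> w x u = 0.

Definition std_simplex : set (n.-tuple (measurableTypeR R)) :=
  [set t | (forall j, 0 <= tnth t j) /\ \sum_j tnth t j <= 1].

Definition param (t : n.-tuple (measurableTypeR R)) : V :=
  v ord0 + \sum_j (tnth t j : R) *: edge j.

(* The integral of an n-form over the simplex, by pullback along the affine
   parametrization. The orientation o is encoded relative to the vertex order:
   (edge 0, ..., edge (n - 1)) is positively oriented iff o = false. *)
Definition integral_form (o : bool) (w : dform R m n) : C :=
  let f t := w (param t) edge in
  (-1) ^+ o *
  ((\int[@lebesgue_tuple R n]_(t in std_simplex) complex.Re (f t)) +i*
   (\int[@lebesgue_tuple R n]_(t in std_simplex) complex.Im (f t)))%C.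

End simplex.

Section whitney.
Context (R : realType) (m n : nat) (lam : 'I_n.+1 -> 'rV[R]_m -> R).
Local Notation V := 'rV[R]_m.
Local Notation C := R[i].

Definition lam_pow r (a : {ffun 'I_n.+1 -> 'I_r.+1}) (x : V) : C :=
  (\prod_i lam i x ^+ a i)%:C%C.

Definition lam_prod k (s : {ffun 'I_k -> 'I_n.+1}) (x : V) : C :=
  (\prod_i lam (s i) x)%:C%C.

Definition dlam k (s : {ffun 'I_k -> 'I_n.+1}) : dform R m k :=
  wedge_all (fun i => ext_d (lam (s i))).

Definition whitney l (s : {ffun 'I_l.+1 -> 'I_n.+1}) : dform R m l :=
  \sum_(p in im s)
    smul (fun x => eps1 C p (del s p) * (lam p x)%:C%C) (dlam (del s p)).

End whitney.

(* Main.v *)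
Require Import Defs.
From mathcomp Require Import all_boot all_order all_algebra fingroup perm.
From mathcomp Require Import complex.
From mathcomp Require Import all_classical all_reals all_analysis.
From mathcomp Require Import ring lra.

(** Fix a point x of T and replace the differentials of the barycentric coordinates
    by independent symbols e_0, ..., e_n. The form under consideration becomes an
    element w of degree k of their exterior algebra. Let s = e_0 + ... + e_n. The
    only linear relation among the differentials is that they add up to 0, so
    passing to T means dividing by s, and w vanishes on T at x if and only if the
    product s /\ w is 0. In coordinates s /\ w is [sum_wedge w], whose component
    on theta is the sum over p in condition (d).

    A Whitney form is the contraction of a basis element by the Euler vector field
    with components lam_i. Summed with the weights eps(rho, rho^c) lam_rho it gives
    the contraction of a Hodge-type dual of w, and duality exchanges contraction
    with multiplication by s: up to the factor (-1)^k the sum is the sum over theta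
    of lam_theta eps(theta, theta^c) (s /\ w)_theta times the differentials of
    theta^c ([sum_whitney]). On the other hand, the product of w with the
    differentials of theta^c, evaluated on the edges of T, is
    eps(theta, theta^c) (s /\ w)_theta ([sum_wedge_dlam]). The two signs cancel and
    the integrand on the left equals, at each point, (-1)^k times the sum over
    theta of lam_theta |(s /\ w)_theta|^2 ([pointwise_identity]). As phi_T is 1 on
    the edges ([whitney_vol]), integration gives the identity.

    The right-hand side is the integral of a nonnegative polynomial. If it is 0,
    the integrand vanishes in the interior ([tame_integral_eq0]), where all lam_i
    are positive, so each (s /\ w)_theta vanishes there. These components are
    homogeneous polynomials in the lam_i, with the sums in (d) as coefficients, and
    distinct monomials of the same degree are linearly independent on the simplex
    ([monomials_free]); this is (d). Conversely (d) gives s /\ w = 0 everywhere,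
    hence (b) by the duality formula, and (a) because bordering a minor by the
    coordinates of a vertex writes the form as a combination of the components of
    s /\ w ([sum_dlam_border]). Both (a) and (b) make a factor of the integrand
    vanish. Finally (c) says that the components of s /\ w on the sets containing 0
    vanish, and the others are determined by these ([sum_wedge_eq0]).

    Signs are handled through sets: the sign of sorting two increasing words one
    after the other is the product of the signs of j - i over all pairs
    ([sort_signE], [eps_incr]), which makes it multiplicative in both words. *)

Set Implicit Arguments.
Unset Strict Implicit.
Unset Printing Implicit Defensive.

Import Order.TTheory GRing.Theory Num.Theory.
Import numFieldNormedType.Exports.
Local Open Scope ring_scope.

(** * Signs of words and alternating functions *)

Section increasing_words.
Context (k n : nat).
Implicit Types (s w : {ffun 'I_k -> 'I_n.+1}) (B : {set 'I_n.+1}).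

Lemma SigmaP s :
  reflect (forall i j : 'I_k, (i < j)%N -> (s i < s j)%N) (s \in Sigma k n).
Proof.
rewrite inE; apply: (iffP forallP) => [H i j|H i].
  by move/forallP: (H i) => /(_ j)/implyP.
by apply/forallP => j; apply/implyP; exact: H.
Qed.

Lemma Sigma_inj s : s \in Sigma k n -> injective s.
Proof.
move=> /SigmaP H i j sij; apply: val_inj.
by case: (ltngtP i j) => // /H; rewrite sij ltnn.
Qed.

Lemma card_im w : injective w -> #|im w| = k.
Proof. by move=> wI; rewrite card_imset// card_ord. Qed.

Lemma enum_set_sorted B : sorted (fun i j : 'I_n.+1 => (i < j)%N) (enum B).
Proof.
rewrite /enum_mem; apply: sorted_filter; first by move=> x y z; exact: ltn_trans.
by have := iota_ltn_sorted 0 n.+1; rewrite -val_enum_ord sorted_map enumT.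
Qed.

Lemma incr_Sigma B : #|B| = k -> incr k B \in Sigma k n.
Proof.
move=> Bk; apply/SigmaP => i j ij; rewrite !ffunE.
apply: (sorted_ltn_nth (leT := fun i j : 'I_n.+1 => (i < j)%N)) => //.
- by move=> x y z; exact: ltn_trans.
- exact: enum_set_sorted.
- by rewrite inE -cardE Bk.
- by rewrite inE -cardE Bk.
Qed.

Lemma im_incr B : #|B| = k -> im (incr k B) = B.
Proof.
move=> Bk; apply/setP => x; apply/imsetP/idP => [[i _ ->]|xB].
  by rewrite ffunE -mem_enum mem_nth// -cardE Bk.
have lx : (index x (enum B) < k)%N by rewrite -Bk cardE index_mem mem_enum.
by exists (Ordinal lx) => //; rewrite ffunE/= nth_index// mem_enum.
Qed.

Lemma Sigma_incr s : s \in Sigma k n -> incr k (im s) = s.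
Proof.
move=> sS; suff E : enum (im s) = [seq s i | i <- enum 'I_k].
  apply/ffunP => i; rewrite ffunE E (nth_map i) ?size_enum_ord//.
  by rewrite nth_ord_enum.
apply: (@irr_sorted_eq _ (fun i j : 'I_n.+1 => (i < j)%N)).
- by move=> x y z; exact: ltn_trans.
- by move=> x; rewrite ltnn.
- exact: enum_set_sorted.
- rewrite sorted_map; apply: (@sub_sorted _ (fun i j : 'I_k => (i < j)%N)).
    by move=> i j /=; exact/SigmaP.
  by have := iota_ltn_sorted 0 k; rewrite -val_enum_ord sorted_map.
- move=> x; rewrite mem_enum; apply/imsetP/mapP => -[i _ ->]; exists i => //.
  by rewrite mem_enum.
Qed.

Lemma big_Sigma (C : nmodType) (F : {ffun 'I_k -> 'I_n.+1} -> C) :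
  \sum_(s in Sigma k n) F s = \sum_(B : {set 'I_n.+1} | #|B| == k) F (incr k B).
Proof.
rewrite (reindex_onto (@incr k n) (@im k n)); last exact: Sigma_incr.
apply: eq_bigl => B; apply/andP/eqP => [[BS /eqP <-]|Bk].
  by rewrite card_im//; exact: Sigma_inj.
by rewrite incr_Sigma// im_incr.
Qed.

(** Whichever sorting permutation is picked, the sorted word is the same, because
    an increasing word is determined by its image. *)
Lemma sort_sign_inj (C : pzRingType) w : injective w ->
  exists s : 'S_k, sort_sign C w = (-1) ^+ s /\
    [ffun i => w (s i)] = incr k (im w).
Proof.
move=> wI; rewrite /sort_sign; case: pickP => [s wsS|noS].
  exists s; split=> //; rewrite -[LHS]Sigma_incr//; congr incr.
  apply/setP => x; apply/imsetP/imsetP => -[i _ ->].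
    by exists (s i); rewrite ?ffunE.
  by exists ((s^-1)%g i); rewrite ?ffunE ?permKV.
have : perm_eq [tuple incr k (im w) i | i < k] [tuple w i | i < k].
  have incI := Sigma_inj (incr_Sigma (card_im wI)).
  apply: uniq_perm; [by rewrite map_inj_uniq -?enumT ?enum_uniq..|move=> x].
  apply/mapP/mapP => [[i _ ->]|[i _ ->]].
    have : incr k (im w) i \in im w.
      by rewrite -{2}(im_incr (card_im wI)) imset_f.
    by move=> /imsetP[j _ ->]; exists j; rewrite ?mem_enum.
  have : w i \in im (incr k (im w)) by rewrite im_incr ?card_im// imset_f.
  by move=> /imsetP[j _ ->]; exists j; rewrite ?mem_enum.
move=> /tuple_permP[s E].
have {}E : [ffun i => w (s i)] = incr k (im w).
  apply/ffunP => i; rewrite ffunE.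
  have : tnth [tuple incr k (im w) i | i < k] i =
         tnth [tuple tnth [tuple w i | i < k] (s i) | i < k] i.
    by congr tnth; apply: val_inj.
  by rewrite !tnth_mktuple.
by have := noS s; rewrite E incr_Sigma// card_im.
Qed.

Lemma sort_sign_repeat (C : pzRingType) w i j : i != j -> w i = w j ->
  sort_sign C w = 0.
Proof.
rewrite /sort_sign; case: pickP => // s wsS /eqP ij wij; case: ij.
apply: (perm_inj (s := s^-1%g)).
by apply: (Sigma_inj wsS); rewrite !ffunE !permKV.
Qed.

(** Sorting w changes an alternating function by the sign of w, and a repeated
    letter makes both sides vanish. Applied to a Vandermonde determinant this
    computes the signs; applied to minors it reduces them to increasing words. *)
Lemma alternating_sort (C : numDomainType) (F : {ffun 'I_k -> 'I_n.+1} -> C) :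
  (forall w (s : 'S_k), F [ffun i => w (s i)] = (-1) ^+ s * F w) ->
  forall w, F w = sort_sign C w * F (incr k (im w)).
Proof.
move=> Falt w; have [/injectiveP wI|/injectivePn[i [j ij wij]]] :=
  boolP (injectiveb w).
  have [s [-> <-]] := sort_sign_inj C wI.
  by rewrite Falt mulrA -signr_addb addbb mul1r.
rewrite (sort_sign_repeat _ ij wij) mul0r.
(* The transposition of the equal letters fixes w and changes the sign of F. *)
have /eqP : F w = - F w.
  rewrite -mulN1r -[-1](expr1) -[X in (-1) ^+ X](_ : nat_of_bool (tperm i j) = _)//.
    rewrite -Falt; congr F; apply/ffunP => l; rewrite ffunE.
    by case: tpermP => // ->.
  by rewrite odd_tperm ij.
by rewrite -addr_eq0 -mulr2n mulrn_eq0/= => /eqP.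
Qed.

End increasing_words.

Definition osg (C : pzRingType) (i j : nat) : C := (Num.sg (j%:Z - i%:Z))%:~R.

(** The Vandermonde determinant of the values of a word is alternating and is
    positive on increasing words, so its sign is the sign of the word. *)
Lemma sort_signE (C : comNzRingType) k n (w : {ffun 'I_k -> 'I_n.+1}) :
  sort_sign C w = \prod_(i < k) \prod_(j < k | (i < j)%N) osg C (w i) (w j).
Proof.
have sgV : forall w : {ffun 'I_k -> 'I_n.+1},
    \prod_(i < k) \prod_(j < k | (i < j)%N) osg int (w i) (w j) =
    Num.sg (\det (Vandermonde k (\row_i (w i)%:Z))).
  move=> w'; rewrite det_Vandermonde (big_morph _ (@sgrM _) (@sgr1 _)).
  apply: eq_bigr => i _; rewrite (big_morph _ (@sgrM _) (@sgr1 _)).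
  by apply: eq_bigr => j _; rewrite !mxE /osg intz.
have osgz (i j : nat) : osg C i j = (osg int i j)%:~R by rewrite /osg intz.
under eq_bigr do (under eq_bigr do rewrite osgz; rewrite -rmorph_prod).
rewrite -rmorph_prod sgV.
have -> : sort_sign C w = (sort_sign int w)%:~R.
  by rewrite /sort_sign; case: pickP => [s _|_] //; rewrite rmorph_sign.
congr (_%:~R); pose F w' : int := Num.sg (\det (Vandermonde k (\row_i (w' i : 'I_n.+1)%:Z))).
rewrite -[RHS]/(F w) (alternating_sort (F := F)) => [|w' s]; last first.
  rewrite /F (_ : Vandermonde _ _ =
      col_perm s (Vandermonde k (\row_i (w' i)%:Z))); last first.
    by apply/matrixP => i j; rewrite !mxE ffunE.
  rewrite col_permE det_mulmx det_perm odd_permV sgrM mulrC; congr (_ * _).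
  by case: (odd_perm s); rewrite ?expr1 ?sgrN1// expr0 sgr1.
have [/injectiveP wI|/injectivePn[i [j ij wij]]] := boolP (injectiveb w); last first.
  by rewrite (sort_sign_repeat _ ij wij) mul0r.
rewrite -[LHS]mulr1; congr (_ * _); rewrite /F -sgV.
apply/esym; rewrite big1// => i _; rewrite big1// => j ij; rewrite /osg gtr0_sg//.
by rewrite subr_gt0 ltz_nat; apply: (SigmaP _ (incr_Sigma (card_im wI))).
Qed.

Section concatenation.
Context (k l n : nat) (s : {ffun 'I_k -> 'I_n.+1}) (t : {ffun 'I_l -> 'I_n.+1}).

Lemma concat_l i : concat s t (lshift l i) = s i.
Proof. by rewrite ffunE (unsplitK (inl i : 'I_k + 'I_l)). Qed.

Lemma concat_r j : concat s t (rshift k j) = t j.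
Proof. by rewrite ffunE (unsplitK (inr j : 'I_k + 'I_l)). Qed.

Lemma im_concat : im (concat s t) = (im s :|: im t)%SET.
Proof.
apply/setP => i; rewrite inE; apply/imsetP/orP => [[j _ ->]|].
  by case: (split_ordP j) => a ->; rewrite ?concat_l ?concat_r; [left|right];
    rewrite imset_f.
case=> /imsetP[j _ ->]; first by exists (lshift l j); rewrite ?concat_l.
by exists (rshift k j); rewrite ?concat_r.
Qed.

End concatenation.

(** * Signs of pairs of sets, and exterior multiplication in coordinates *)

Section signs.
Context (C : numDomainType).

Lemma osgC i j : osg C j i = - osg C i j.
Proof. by rewrite /osg -opprB sgrN rmorphN. Qed.

Lemma osgii i : osg C i i = 0.
Proof. by rewrite /osg subrr sgr0. Qed.

Lemma osg_lt i j : (i < j)%N -> osg C i j = 1.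
Proof. by move=> ij; rewrite /osg gtr0_sg// subr_gt0 ltz_nat. Qed.

Lemma osg_sqr i j : i != j -> osg C i j * osg C i j = 1.
Proof.
rewrite neq_ltn => /orP[|] ij; first by rewrite osg_lt// mulr1.
by rewrite osgC osg_lt// mulrNN mulr1.
Qed.

Context (n : nat).
Implicit Types (A B : {set 'I_n.+1}) (p q : 'I_n.+1).

(** The sign of moving p in front of the increasing word with image A. *)
Definition sg1 p A : C := \prod_(j in A) osg C p j.

(** The sign of sorting the increasing word with image A followed by the one
    with image B. It is multiplicative in both sets and vanishes unless they
    are disjoint. *)
Definition sgs A B : C := \prod_(i in A) sg1 i B.

Lemma sort_sign_Sigma k (s : {ffun 'I_k -> 'I_n.+1}) :
  s \in Sigma k n -> sort_sign C s = 1.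
Proof.
move=> /SigmaP sS; rewrite sort_signE big1// => i _; rewrite big1// => j ij.
by rewrite osg_lt// sS.
Qed.

Lemma sort_sign_concat k l (s : {ffun 'I_k -> 'I_n.+1})
    (t : {ffun 'I_l -> 'I_n.+1}) :
  sort_sign C (concat s t) =
  sort_sign C s * sort_sign C t * \prod_i \prod_j osg C (s i) (t j).
Proof.
rewrite !sort_signE big_split_ord/= -mulrA [X in _ = _ * X]mulrC mulrA.
congr (_ * _).
  rewrite -big_split; apply: eq_bigr => i _; rewrite big_split_ord/=.
  congr (_ * _); first by apply: eq_bigr => j _; rewrite !concat_l.
  apply: eq_big => [j|j _]; last by rewrite concat_l concat_r.
  by rewrite ltn_addr.
apply: eq_bigr => i _; rewrite big_split_ord/= big_pred0 ?mul1r => [|j].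
  apply: eq_big => [j|j _]; last by rewrite !concat_r.
  by rewrite ltn_add2l.
by apply/negbTE; rewrite -leqNgt ltnW// ltn_addr.
Qed.

Lemma prod_incr k A (F : 'I_n.+1 -> C) : #|A| = k ->
  \prod_(i < k) F (incr k A i) = \prod_(i in A) F i.
Proof.
move=> Ak; rewrite -{2}(im_incr Ak) big_imset//= => i j _ _.
exact: Sigma_inj (incr_Sigma Ak) _ _.
Qed.

Lemma eps_incr k l A B : #|A| = k -> #|B| = l ->
  eps C (incr k A) (incr l B) = sgs A B.
Proof.
move=> Ak Bl; rewrite /eps sort_sign_concat !sort_sign_Sigma ?incr_Sigma//.
rewrite !mul1r /sgs -(prod_incr (sg1^~ B) Ak); apply: eq_bigr => i _.
exact: prod_incr.
Qed.

Lemma sort_sign_cons q l (t : {ffun 'I_l -> 'I_n.+1}) :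
  sort_sign C (concat [ffun _ : 'I_1 => q] t) =
  sort_sign C t * \prod_j osg C q (t j).
Proof.
rewrite sort_sign_concat big_ord1 sort_sign_Sigma ?mul1r ?ffunE//.
by apply/SigmaP => i j; rewrite !ord1.
Qed.

Lemma eps1_incr q l B : #|B| = l -> eps1 C q (incr l B) = sg1 q B.
Proof.
move=> Bl; rewrite /eps1 /eps sort_sign_cons sort_sign_Sigma ?incr_Sigma//.
by rewrite mul1r /sg1 -(prod_incr (fun j => osg C q j) Bl).
Qed.

Lemma sg1_eq0 p B : p \in B -> sg1 p B = 0.
Proof. by move=> pB; rewrite /sg1 (bigD1 p)//= osgii mul0r. Qed.

Lemma sg1_sqr p B : p \notin B -> sg1 p B * sg1 p B = 1.
Proof.
move=> pB; rewrite -big_split big1// => j jB; apply: osg_sqr.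
by apply: contraNneq pB => /val_inj ->.
Qed.

Lemma sgs_eq0 i A B : i \in A -> i \in B -> sgs A B = 0.
Proof. by move=> iA iB; rewrite /sgs (bigD1 i)//= sg1_eq0// mul0r. Qed.

Lemma sgs_compl_sqr A : sgs A (~: A) * sgs A (~: A) = 1.
Proof.
by rewrite -big_split big1// => i iA; rewrite /= sg1_sqr// inE negbK.
Qed.

Lemma sg1U1 p q B : q \notin B -> sg1 p (q |: B) = osg C p q * sg1 p B.
Proof. by move=> qB; rewrite /sg1 big_setU1. Qed.

Lemma sg1D1 p q B : q \in B -> sg1 p B = osg C p q * sg1 p (B :\ q).
Proof. by move=> qB; rewrite /sg1 (big_setD1 q). Qed.

Lemma sgsD1 p A B : p \in A -> sgs A B = sg1 p B * sgs (A :\ p) B.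
Proof. by move=> pA; rewrite /sgs (big_setD1 p). Qed.

Lemma sgsU1 p A B : p \notin A -> sgs (p |: A) B = sg1 p B * sgs A B.
Proof. by move=> pA; rewrite /sgs big_setU1. Qed.

Lemma sgsU1r p A B : p \notin B ->
  sgs A (p |: B) = (-1) ^+ #|A| * sg1 p A * sgs A B.
Proof.
move=> pB; rewrite /sgs; under eq_bigr do rewrite sg1U1// osgC -mulN1r.
by rewrite !big_split/= prodr_const.
Qed.

(** Both sides run over the nested pairs of a set A of size k and a set B of size
    k + 1, where q and p are the element of B outside A. *)
Lemma sum_flag k (F : {set 'I_n.+1} -> 'I_n.+1 -> C) :
  \sum_(A : {set 'I_n.+1} | #|A| == k) \sum_(q | q \notin A) F A q =
  \sum_(B : {set 'I_n.+1} | #|B| == k.+1) \sum_(p in B) F (B :\ p) p.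
Proof.
rewrite !pair_big_dep/=.
rewrite (reindex_onto (fun u : {set 'I_n.+1} * 'I_n.+1 => (u.1 :\ u.2, u.2))
  (fun u => (u.2 |: u.1, u.2))) /= => [|[A q] /= /andP[_ qA]]; last first.
  by rewrite finset.setU1K.
apply: eq_bigl => -[B p] /=; rewrite !inE eqxx/= andbT xpair_eqE eqxx andbT.
have [pB|pB] := boolP (p \in B).
  by rewrite finset.setD1K// eqxx andbT (cardsD1 p B) pB eqSS andbT.
rewrite andbF; apply/negbTE; apply: contra pB => /andP[_ /eqP <-].
exact: finset.setU11.
Qed.

(** Left exterior multiplication by the sum of all basis covectors, in
    coordinates. *)
Definition sum_wedge (w : {set 'I_n.+1} -> C) B : C :=
  \sum_(p in B) sg1 p (B :\ p) * w (B :\ p).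

(** Both products sort the word formed by A, p and the complement of B; moving p
    past A costs the sign on the right. *)
Lemma sign_exchange p B : p \in B ->
  sgs (B :\ p) (~: (B :\ p)) * sg1 p (~: B) =
  (-1) ^+ #|B|.-1 * sg1 p (B :\ p) * sgs B (~: B).
Proof.
move=> pB; have -> : ~: (B :\ p) = p |: ~: B by rewrite finset.setCD finset.setUC.
rewrite sgsU1r ?inE ?pB// (sgsD1 _ pB) (cardsD1 p B) pB/=.
by rewrite -!mulrA; congr (_ * (_ * _)); rewrite mulrC.
Qed.

(** With H T in the place of the basis covector of T, the sum over p is a Whitney
    form, the contraction of a basis element by the Euler vector field l. The
    identity is the duality between this contraction and sum_wedge: a term on
    either side is a set B with a marked element p, where A is B minus p. *)
Lemma sum_whitney k (l : 'I_n.+1 -> C) (w H : {set 'I_n.+1} -> C) :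
  \sum_(A : {set 'I_n.+1} | #|A| == k) sgs A (~: A) * w A * (\prod_(i in A) l i) *
    (\sum_(p in ~: A) sg1 p (~: A :\ p) * l p * H (~: A :\ p)) =
  (-1) ^+ k * \sum_(B : {set 'I_n.+1} | #|B| == k.+1)
    (\prod_(i in B) l i) * sgs B (~: B) * sum_wedge w B * H (~: B).
Proof.
pose F (A : {set 'I_n.+1}) p := sgs A (~: A) * w A * (\prod_(i in A) l i) *
  (sg1 p (~: A :\ p) * l p * H (~: A :\ p)).
transitivity (\sum_(A : {set 'I_n.+1} | #|A| == k) \sum_(p | p \notin A) F A p).
  apply: eq_bigr => A _; rewrite mulr_sumr; apply: eq_bigl => p.
  by rewrite finset.in_setC.
rewrite sum_flag mulr_sumr; apply: eq_bigr => B /eqP Bk.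
rewrite /sum_wedge mulr_sumr mulr_suml mulr_sumr /F; apply: eq_bigr => p pB.
have -> : ~: (B :\ p) :\ p = ~: B.
  by rewrite finset.setCD finset.setUC finset.setU1K// inE pB.
rewrite (big_setD1 p pB)/=; have := sign_exchange pB; rewrite Bk/= => E.
transitivity ((sgs (B :\ p) (~: (B :\ p)) * sg1 p (~: B)) * w (B :\ p) *
  (l p * \prod_(i in B :\ p) l i) * H (~: B)); first by ring.
by rewrite E; ring.
Qed.

(** A factor vanishes when q is in A, when q is outside B, or when A meets the
    complement of B, so that only A equal to B minus q survives. *)
Lemma sum_wedge_compl k (w : {set 'I_n.+1} -> C) B : #|B| = k.+1 ->
  \sum_(A : {set 'I_n.+1} | #|A| == k) w A *
    \sum_q sgs A (~: B) * (sg1 q A * sg1 q (~: B)) =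
  sgs B (~: B) * sum_wedge w B.
Proof.
move=> Bk; transitivity (\sum_(A : {set 'I_n.+1} | #|A| == k) \sum_(q | q \notin A)
    sg1 q A * w A * sgs (q |: A) (~: B)).
  apply: eq_bigr => A _; rewrite mulr_sumr (bigID (mem A))/= big1 ?add0r.
    by apply: eq_bigr => q qA; rewrite sgsU1//; ring.
  by move=> q qA; rewrite sg1_eq0// mul0r !mulr0.
rewrite sum_flag (bigD1 B) ?Bk//= [X in _ + X]big1 ?addr0 => [|B' /andP[/eqP B'k BB']].
  by rewrite mulr_sumr; apply: eq_bigr => p pB; rewrite finset.setD1K// mulrC.
apply: big1 => p pB'; rewrite finset.setD1K//.
have [B'B|/subsetPn[x xB' xB]] := boolP (B' \subset B).
  by move: BB'; rewrite eqEcard B'B Bk B'k leqnn.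
by rewrite (@sgs_eq0 x) ?mulr0// inE.
Qed.

(** The right-hand condition says that the components of sum_wedge w on sets with
    0 vanish. It expresses w on sets without 0 by its values on sets with 0, and
    inserting this into a component of sum_wedge w on a set without 0 gives a
    double sum that is antisymmetric in the two removed elements. *)
Lemma sum_wedge_eq0 k (w : {set 'I_n.+1} -> C) :
  (forall B, #|B| = k.+1 -> sum_wedge w B = 0) <->
  (forall A, #|A| = k -> ord0 \notin A ->
    w A - \sum_(p in A) sg1 p (A :\ p) * w (ord0 |: (A :\ p)) = 0).
Proof.
have sg0 A : ord0 \notin A -> sg1 ord0 A = 1.
  move=> A0; rewrite /sg1 big1// => j jA; rewrite osg_lt// lt0n.
  by apply: contraNneq A0 => j0; rewrite (_ : ord0 = j)//; apply: val_inj.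
have wedge0 A : ord0 \notin A -> sum_wedge w (ord0 |: A) =
    w A - \sum_(p in A) sg1 p (A :\ p) * w (ord0 |: (A :\ p)).
  move=> A0; rewrite /sum_wedge big_setU1//= finset.setU1K// sg0// mul1r; congr (_ + _).
  rewrite -sumrN; apply: eq_bigr => p pA.
  have p0 : p != ord0 by apply: contraNneq A0 => <-.
  have -> : (ord0 |: A) :\ p = ord0 |: (A :\ p).
    by apply/setP => x; rewrite !inE; case: eqP => // ->; rewrite (negbTE p0).
  rewrite sg1U1 ?inE ?(negbTE A0) ?andbF// osgC osg_lt ?lt0n//.
  by rewrite mulN1r mulNr.
split=> [H A Ak A0|H B Bk].
  by rewrite -wedge0// H// cardsU1 A0 Ak.
have [B0|B0] := boolP (ord0 \in B).
  rewrite -(finset.setD1K B0) wedge0 ?finset.setD11// H ?finset.setD11//.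
  by apply/eqP; rewrite -eqSS -Bk (cardsD1 ord0 B) B0.
pose G p q := sg1 p (B :\ p) * (sg1 q (B :\ p :\ q) * w (ord0 |: (B :\ p :\ q))).
have E : sum_wedge w B = \sum_(p in B) \sum_(q in B | q != p) G p q.
  apply: eq_bigr => p pB.
  rewrite -[w _](subrK (\sum_(q in B :\ p)
    sg1 q (B :\ p :\ q) * w (ord0 |: (B :\ p :\ q)))).
  rewrite H ?add0r; first last.
  - by rewrite inE (negbTE B0) andbF.
  - by apply/eqP; rewrite -eqSS -Bk (cardsD1 p B) pB.
  rewrite mulr_sumr; apply: eq_bigl => q.
  by rewrite !inE andbC.
have GN p q : p \in B -> q \in B -> q != p -> G p q = - G q p.
  move=> pB qB qp; rewrite /G.
  have -> : B :\ q :\ p = B :\ p :\ q by rewrite !finset.setDDl finset.setUC.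
  rewrite (sg1D1 p (q := q)) ?inE ?qp// (sg1D1 q (q := p) (B := B :\ q)) ?inE 1?eq_sym ?qp//.
  have -> : B :\ q :\ p = B :\ p :\ q by rewrite !finset.setDDl finset.setUC.
  by rewrite (osgC q p); ring.
have : sum_wedge w B = - sum_wedge w B.
  rewrite {1}E (exchange_big_dep (mem B))/=; last by move=> p q _ /andP[].
  rewrite E -sumrN; apply: eq_bigr => p pB; rewrite -sumrN.
  apply: eq_big => [q|q /andP[qB qp]]; first by rewrite pB eq_sym.
  by rewrite GN//; case/andP: qp.
move/eqP; rewrite -addr_eq0 -mulr2n mulrn_eq0/= => /eqP //.
Qed.

End signs.

(** * Minors and the Laplace expansion *)

Section block_perm.
Context (k l : nat) (p : 'S_k) (q : 'S_l).

Let f (i : 'I_(k + l)) : 'I_(k + l) :=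
  match fintype.split i with inl a => lshift l (p a) | inr b => rshift k (q b) end.

Let f_inj : injective f.
Proof.
move=> i j; rewrite /f.
case: (split_ordP i) => a ->; case: (split_ordP j) => b -> /eqP.
- by rewrite eq_lshift => /eqP/perm_inj ->.
- by rewrite eq_lrshift.
- by rewrite eq_rlshift.
- by rewrite eq_rshift => /eqP/perm_inj ->.
Qed.

Definition block_perm : 'S_(k + l) := perm f_inj.

Lemma block_perm_l i : block_perm (lshift l i) = lshift l (p i).
Proof. by rewrite permE /f (unsplitK (inl i : 'I_k + 'I_l)). Qed.

Lemma block_perm_r i : block_perm (rshift k i) = rshift k (q i).
Proof. by rewrite permE /f (unsplitK (inr i : 'I_k + 'I_l)). Qed.

Lemma sign_block_perm (C : comNzRingType) :
  (-1) ^+ block_perm = (-1) ^+ p * (-1) ^+ q :> C.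
Proof.
rewrite -!det_perm -(det_ublock _ 0); congr (\det _); apply/matrixP => i j.
case: (split_ordP i) => a ->; case: (split_ordP j) => b ->.
- by rewrite block_mxEul !mxE block_perm_l eq_lshift.
- by rewrite block_mxEur !mxE block_perm_l eq_lrshift.
- by rewrite block_mxEdl !mxE block_perm_r eq_rlshift.
- by rewrite block_mxEdr !mxE block_perm_r eq_rshift.
Qed.

End block_perm.

(** Laplace expansion in symmetrized form: each pair of permutations of the two
    blocks extends to a block permutation, which the sum over s absorbs, so that
    the determinant is counted k! l! times. *)
Lemma det_shuffle (C : numFieldType) k l (M : 'M[C]_(k + l)) :
  (k`! * l`!)%N%:R^-1 * (\sum_(s : 'S_(k + l)) (-1) ^+ s *
    \det (\matrix_(i, j) M (lshift l i) (s (lshift l j))) *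
    \det (\matrix_(i, j) M (rshift k i) (s (rshift k j)))) = \det M.
Proof.
have -> : \sum_(s : 'S_(k + l)) (-1) ^+ s *
    \det (\matrix_(i, j) M (lshift l i) (s (lshift l j))) *
    \det (\matrix_(i, j) M (rshift k i) (s (rshift k j))) =
    \sum_(p : 'S_k) \sum_(q : 'S_l) \det M.
  under eq_bigr => s _.
    rewrite /determinant -mulrA mulr_suml mulr_sumr.
    under eq_bigr do rewrite mulr_sumr mulr_sumr.
    over.
  rewrite exchange_big; apply: eq_bigr => p _.
  rewrite exchange_big; apply: eq_bigr => q _.
  rewrite /determinant (reindex_inj (mulgI (block_perm p q)^-1%g))/=.
  apply: eq_bigr => s _; rewrite odd_permM odd_permV signr_addb sign_block_perm.
  rewrite big_split_ord/=.
  under eq_bigr do rewrite mxE permM -(block_perm_l p q) permK.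
  under [X in _ * (_ * _ * (_ * X))]eq_bigr do
    rewrite mxE permM -(block_perm_r p q) permK.
  have sq (b : bool) : (-1) ^+ b * (-1) ^+ b = 1 :> C by rewrite -signr_addb addbb.
  have E (a b c x y : C) : a * b * c * (a * x * (b * y)) =
    (a * a) * (b * b) * (c * (x * y)) by ring.
  by rewrite E !sq !mul1r.
rewrite !sumr_const (card_Sn k) (card_Sn l) -mulrnA -[\det M *+ _]mulr_natl mulrA.
rewrite [(l`! * _)%N]mulnC mulVf ?mul1r//.
Qed.

Definition minor (C : comNzRingType) n k (M : 'M[C]_(n, k)) (w : 'I_k -> 'I_n) : C :=
  \det (rowsub w M).

(** Adding a column y with entries of sum 1 to a matrix whose columns have sum 0:
    the sum of all rows is (1, 0), which serves as an additional first row. *)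
Lemma minor_border (C : comNzRingType) n k (y : 'cV[C]_n.+1) (M : 'M[C]_(n.+1, k))
    (w : {ffun 'I_k -> 'I_n.+1}) :
  \sum_i y i 0 = 1 -> (forall j, \sum_i M i j = 0) ->
  minor M w = \sum_q minor (row_mx y M) (concat [ffun _ : 'I_1 => q] w).
Proof.
move=> y1 M0; pose R q := rowsub (concat [ffun _ : 'I_1 => q] w) (row_mx y M).
have R0 q j : R q ord0 j = row_mx y M q j.
  by rewrite mxE ffunE; case: split_ordP => [a _|b /eqP]; rewrite ?ffunE.
have RS q i j : R q (lift ord0 i) j = row_mx y M (w i) j.
  by rewrite mxE (_ : lift ord0 i = rshift 1 i) ?concat_r//; exact: val_inj.
pose c j := cofactor (R ord0) ord0 j.
have Rc q j : cofactor (R q) ord0 j = c j.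
  rewrite /c /cofactor; congr (_ * \det _); apply/matrixP => a b.
  have E (A : 'M[C]_(1 + k)) : row' ord0 (col' j A) a b = A (lift ord0 a) (lift j b).
    by rewrite !mxE.
  by rewrite !E !RS.
rewrite /minor; under eq_bigr => q _ do
  (rewrite (expand_det_row _ ord0); under eq_bigr do rewrite -/(R q) Rc R0).
rewrite exchange_big/=; under eq_bigr do rewrite -mulr_suml.
have yl q : row_mx y M q ord0 = y q 0.
  by rewrite -(row_mxEl y M); congr (row_mx y M q _); apply: val_inj.
have Mr q j : row_mx y M q (lift ord0 j) = M q j.
  by rewrite -(row_mxEr y M); congr (row_mx y M q _); apply: val_inj.
rewrite big_ord_recl [X in _ + X]big1 ?addr0 => [|j _].
  under eq_bigr do rewrite yl.
  rewrite y1 mul1r /c /cofactor expr0 mul1r.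
  congr (\det _); apply/matrixP => i j.
  by rewrite mxE [RHS]mxE [RHS]mxE RS Mr.
by under eq_bigr do rewrite Mr; rewrite M0 mul0r.
Qed.

Lemma minor_alt (C : comNzRingType) n k (M : 'M[C]_(n, k)) (w : {ffun 'I_k -> 'I_n})
    (s : 'S_k) : minor M [ffun i => w (s i)] = (-1) ^+ s * minor M w.
Proof.
rewrite /minor (_ : rowsub _ _ = row_perm s (rowsub w M)).
  by rewrite row_permE det_mulmx det_perm.
by apply/matrixP => i j; rewrite !mxE ffunE.
Qed.

Lemma minor_sort (C : numDomainType) n k (M : 'M[C]_(n.+1, k))
    (w : {ffun 'I_k -> 'I_n.+1}) :
  minor M w = sort_sign C w * minor M (incr k (im w)).
Proof. by apply: (alternating_sort (F := fun w => minor M w)) => w' s; exact: minor_alt. Qed.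

(** * Wedge products of forms, and affine functions *)

Section forms.
Context (R : realType) (m : nat).
Local Notation V := 'rV[R]_m.
Local Notation C := R[i].
Local Notation dform := (dform R m).

Lemma dform_sumE k (I : Type) (r : seq I) (P : pred I) (F : I -> dform k) x u :
  (\sum_(i <- r | P i) F i) x u = \sum_(i <- r | P i) F i x u.
Proof. by apply: (big_morph (fun w : dform k => w x u)). Qed.

Lemma wedge_smull k l (f : V -> C) (w : dform k) (z : dform l) x u :
  wedge (smul f w) z x u = f x * wedge w z x u.
Proof.
rewrite /wedge mulrCA; congr (_ * _); rewrite mulr_sumr; apply: eq_bigr => s _.
by rewrite /smul [(-1) ^+ s * _]mulrCA -!mulrA.
Qed.

Lemma wedge_smulr k l (f : V -> C) (w : dform k) (z : dform l) x u :
  wedge w (smul f z) x u = f x * wedge w z x u.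
Proof.
rewrite /wedge mulrCA; congr (_ * _); rewrite mulr_sumr; apply: eq_bigr => s _.
by rewrite /smul mulrCA.
Qed.

Lemma wedge_suml k l (I : Type) (r : seq I) (P : pred I) (F : I -> dform k)
    (z : dform l) x u :
  wedge (\sum_(i <- r | P i) F i) z x u = \sum_(i <- r | P i) wedge (F i) z x u.
Proof.
rewrite /wedge -mulr_sumr exchange_big; congr (_ * _); apply: eq_bigr => s _.
by rewrite dform_sumE mulr_sumr mulr_suml.
Qed.

Lemma wedge_sumr k l (I : Type) (r : seq I) (P : pred I) (F : I -> dform l)
    (w : dform k) x u :
  wedge w (\sum_(i <- r | P i) F i) x u = \sum_(i <- r | P i) wedge w (F i) x u.
Proof.
rewrite /wedge -mulr_sumr exchange_big; congr (_ * _); apply: eq_bigr => s _.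
by rewrite dform_sumE mulr_sumr.
Qed.

Lemma wedge_eq0l k l (w : dform k) (z : dform l) x (u : 'I_(k + l) -> V) :
  (forall f : 'I_k -> 'I_(k + l), w x (u \o f) = 0) -> wedge w z x u = 0.
Proof.
move=> w0; rewrite /wedge big1 ?mulr0// => s _.
by rewrite (w0 (fun i => s (lshift l i))) mulr0 mul0r.
Qed.

Lemma wedge_eq0r k l (w : dform k) (z : dform l) x (u : 'I_(k + l) -> V) :
  (forall f : 'I_l -> 'I_(k + l), z x (u \o f) = 0) -> wedge w z x u = 0.
Proof.
move=> z0; rewrite /wedge big1 ?mulr0// => s _.
by rewrite (z0 (fun i => s (rshift k i))) mulr0.
Qed.

Lemma wedge_det k l (w : dform k) (z : dform l) x
    (f : 'I_k -> V -> C) (g : 'I_l -> V -> C) :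
  (forall u, w x u = \det (\matrix_(i, j) f i (u j))) ->
  (forall u, z x u = \det (\matrix_(i, j) g i (u j))) ->
  forall u, wedge w z x u = \det (\matrix_(i < k + l, j < k + l)
    match fintype.split i with inl a => f a | inr b => g b end (u j)).
Proof.
move=> wE zE u; set M := \matrix_(_, _) _; rewrite -[RHS]det_shuffle.
congr (_ * _); apply: eq_bigr => s _; rewrite wE zE.
have -> : \matrix_(i, j) f i (u (s (lshift l j))) =
    \matrix_(i, j) M (lshift l i) (s (lshift l j)).
  by apply/matrixP => i j; rewrite !mxE (unsplitK (inl i : 'I_k + 'I_l)).
have -> : \matrix_(i, j) g i (u (s (rshift k j))) =
    \matrix_(i, j) M (rshift k i) (s (rshift k j)).
  by apply/matrixP => i j; rewrite !mxE (unsplitK (inr i : 'I_k + 'I_l)).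
by [].
Qed.

Lemma wedge_allE k (w : 'I_k -> dform 1) x u :
  wedge_all w x u = \det (\matrix_(i, j) w i x (fun=> u j)).
Proof.
elim: k w u => [|k IHk] w u; first by rewrite det_mx00.
rewrite [LHS](@wedge_det 1 k _ _ x (fun _ y => w ord0 x (fun=> y))
  (fun i y => w (lift ord0 i) x (fun=> y))) => [|z|z]; last exact: IHk.
  congr (\det _); apply/matrixP => i j; rewrite !mxE.
  case: split_ordP => a ->; first by rewrite ord1; congr (w _ x _); apply: val_inj.
  by congr (w _ x _); apply: val_inj.
by rewrite det_mx11 mxE; congr (w _ x _); apply/funext => i; rewrite ord1.
Qed.

Definition lin_part (f : V -> R) (u : V) : R := f u - f 0.

Section affine.
Context (f : V -> R) (faff : affine_fun f).

Lemma lin_partZ a u : lin_part f (a *: u) = a * lin_part f u.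
Proof.
by have := faff a u 0; rewrite scaler0 addr0 /lin_part => ->; ring.
Qed.

Lemma lin_partD u w : lin_part f (u + w) = lin_part f u + lin_part f w.
Proof.
have /(congr1 (fun y => y - f 0)) := faff 2^-1 (2 *: u) (2 *: w).
have -> : 1 - 2^-1 = 2^-1 :> R by field.
rewrite !scalerA mulVf ?pnatr_eq0// !scale1r -/(lin_part f _) => ->.
have := lin_partZ 2 u; have := lin_partZ 2 w; rewrite /lin_part.
lra.
Qed.

Lemma lin_part_sum I (r : seq I) (P : pred I) (c : I -> R) (F : I -> V) :
  lin_part f (\sum_(i <- r | P i) c i *: F i) =
  \sum_(i <- r | P i) c i * lin_part f (F i).
Proof.
have L0 : lin_part f 0 = 0 by rewrite /lin_part subrr.
rewrite (big_morph _ lin_partD L0); apply: eq_bigr => i _; exact: lin_partZ.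
Qed.

Lemma affineD x u : f (x + u) = f x + lin_part f u.
Proof. by have := lin_partD x u; rewrite /lin_part; lra. Qed.

Lemma affine_comb n (c : 'I_n.+1 -> R) (y : 'I_n.+1 -> V) : \sum_i c i = 1 ->
  f (\sum_i c i *: y i) = \sum_i c i * f (y i).
Proof.
move=> c1; have := affineD 0 (\sum_i c i *: y i); rewrite add0r => ->.
rewrite lin_part_sum /lin_part; under eq_bigr do rewrite mulrBr.
by rewrite sumrB -mulr_suml c1 mul1r addrC subrK.
Qed.

Lemma derive_affine x u : 'D_u f x = lin_part f u.
Proof.
rewrite /derive; apply: cvg_lim; first exact: Rhausdorff.
apply: cvg_near_cst.
near=> h; rewrite /= (addrC (h *: u)) affineD lin_partZ addrAC subrr add0r.
rewrite /GRing.scale/= mulrA mulVf ?mul1r//.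
by near: h; exact: nbhs_dnbhs_neq.
Unshelve. all: by end_near. Qed.

End affine.

End forms.

(** * Differentials of barycentric coordinates and Whitney forms *)

Section barycentric_forms.
Context (R : realType) (m n : nat) (v : 'I_n.+1 -> 'rV[R]_m).
Context (lam : 'I_n.+1 -> 'rV[R]_m -> R) (hlam : barycentric v lam).
Local Notation V := 'rV[R]_m.
Local Notation C := R[i].
Implicit Types (A B : {set 'I_n.+1}) (t : n.-tuple (measurableTypeR R)).

Let laff i : affine_fun (lam i) := hlam.1 i.
Let lamv i j : lam i (v j) = (i == j)%:R := hlam.2 i j.

Lemma lam_comb (c : 'I_n.+1 -> R) i : \sum_j c j = 1 ->
  lam i (\sum_j c j *: v j) = c i.
Proof.
move=> c1; rewrite (affine_comb (laff i))// (bigD1 i)//= lamv eqxx mulr1.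
by rewrite big1 ?addr0// => j ji; rewrite lamv eq_sym (negbTE ji) mulr0.
Qed.

Lemma lin_part_edge i j :
  lin_part (lam i) (edge v j) = (i == lift ord0 j)%:R - (i == ord0)%:R.
Proof.
have := affineD (laff i) (v ord0) (edge v j).
by rewrite {1}/edge [v ord0 + _]addrC subrK !lamv => ->; rewrite addrAC subrr add0r.
Qed.

Lemma param_comb t : param v t =
  \sum_i (oapp (tnth t) (1 - \sum_j tnth t j) (unlift ord0 i) : R) *: v i.
Proof.
rewrite big_ord_recl unlift_none/=; under [X in _ + X]eq_bigr do rewrite liftK/=.
rewrite /param /edge; under [X in _ + X = _]eq_bigr do rewrite scalerBr.
by rewrite sumrB scalerBl scale1r -scaler_suml -addrA [- _ + _]addrC.
Qed.

Lemma param_comb1 t :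
  \sum_i (oapp (tnth t) (1 - \sum_j tnth t j) (unlift ord0 i) : R) = 1.
Proof.
rewrite big_ord_recl unlift_none/=.
by under [X in _ + X]eq_bigr do rewrite liftK/=; rewrite subrK.
Qed.

(** In the affine parametrization the coordinates of t are the last n barycentric
    coordinates, and the first one is what remains up to 1. *)
Lemma lam_param t i :
  lam i (param v t) = oapp (tnth t) (1 - \sum_j tnth t j) (unlift ord0 i).
Proof. by rewrite param_comb lam_comb// param_comb1. Qed.

Lemma param_simplex t : std_simplex t -> simplex v (param v t).
Proof.
move=> [t0 t1]; eexists; split; last exact: param_comb.
  by move=> i /=; case: (unliftP ord0 i) => [j _|_]//=; rewrite subr_ge0.
exact: param_comb1.
Qed.

Lemma lam_simplex_ge0 x i : simplex v x -> 0 <= lam i x.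
Proof. by move=> [c [c0 c1 ->]]; rewrite lam_comb. Qed.

Lemma lam_simplex_sum x : simplex v x -> \sum_i lam i x = 1.
Proof.
by move=> [c [c0 c1 ->]]; rewrite -[RHS]c1; apply: eq_bigr => i _; rewrite lam_comb.
Qed.

Lemma tangent_edge j : tangent v (edge v j).
Proof.
exists (fun i => (i == j)%:R); rewrite (bigD1 j)//= eqxx scale1r big1 ?addr0// => i ij.
by rewrite (negbTE ij) scale0r.
Qed.

(** The values of the differentials of all barycentric coordinates on a family
    of vectors. *)
Definition dlam_mx k (u : 'I_k -> V) : 'M[C]_(n.+1, k) :=
  \matrix_(i, j) (lin_part (lam i) (u j))%:C%C.

Lemma dlamE k (s : {ffun 'I_k -> 'I_n.+1}) x u :
  dlam lam s x u = minor (dlam_mx u) s.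
Proof.
rewrite /dlam wedge_allE; congr (\det _); apply/matrixP => i j; rewrite !mxE.
by rewrite /ext_d derive_affine.
Qed.

Lemma wedge_dlam k l (s : {ffun 'I_k -> 'I_n.+1}) (t : {ffun 'I_l -> 'I_n.+1}) x u :
  wedge (dlam lam s) (dlam lam t) x u = minor (dlam_mx u) (concat s t).
Proof.
rewrite (wedge_det (f := fun i y => (lin_part (lam (s i)) y)%:C%C)
  (g := fun i y => (lin_part (lam (t i)) y)%:C%C)).
- congr (\det _); apply/matrixP => i j; rewrite !mxE ffunE.
  by case: fintype.split.
- by move=> y; rewrite dlamE; congr (\det _); apply/matrixP => i j; rewrite !mxE.
- by move=> y; rewrite dlamE; congr (\det _); apply/matrixP => i j; rewrite !mxE.
Qed.

Lemma dlam_mx_sum0 k (u : 'I_k -> V) j : (forall i, tangent v (u i)) ->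
  \sum_i dlam_mx u i j = 0.
Proof.
move=> /(_ j)[c uj]; under eq_bigr do rewrite mxE uj.
rewrite -rmorph_sum/=; under eq_bigr do rewrite (lin_part_sum (laff _)).
rewrite exchange_big/= big1// => l _; rewrite -mulr_sumr.
under eq_bigr do rewrite lin_part_edge.
rewrite sumrB; suff S i : \sum_(q < n.+1) (q == i)%:R = 1 :> R by rewrite !S subrr mulr0.
by rewrite (bigD1 i)//= eqxx big1 ?addr0// => q /negbTE ->.
Qed.

(** The border column holds the barycentric coordinates of the vertex v ord0, which
    makes the matrix triangular with unit diagonal. *)
Lemma det_edges : minor (row_mx (\col_i (i == ord0)%:R) (dlam_mx (edge v)))
  (incr n.+1 [set: 'I_n.+1]) = 1.
Proof.
have -> : incr n.+1 [set: 'I_n.+1] = [ffun i => i].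
  rewrite -[RHS]Sigma_incr; last by apply/SigmaP => i j; rewrite !ffunE.
  congr incr; apply/setP => i; rewrite inE; apply/esym/imsetP.
  by exists i; rewrite ?ffunE.
rewrite /minor -det_tr det_trig.
  rewrite big1// => i _; rewrite !mxE ffunE.
  case: split_ordP => j ->; rewrite !mxE; first by rewrite (ord1 j).
  rewrite lin_part_edge; have -> : rshift 1 j = lift ord0 j :> 'I_n.+1 by exact: val_inj.
  by rewrite eqxx subr0.
apply/is_trig_mxP => i j ij; rewrite !mxE ffunE.
have j0 : (j == ord0) = false by apply/negbTE; rewrite -lt0n (leq_ltn_trans _ ij).
case: split_ordP ij => a ->; rewrite !mxE; first by rewrite j0.
rewrite lin_part_edge j0 subr0 => /ltn_eqF.
have -> : rshift 1 a = lift ord0 a :> 'I_n.+1 by exact: val_inj.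
by rewrite eq_sym -(inj_eq val_inj) => ->.
Qed.

(** A word of length n has a vanishing minor unless exactly one letter is missing,
    and then the minor is the sign of prefixing the missing letter; the sum over
    all prefixes q covers both cases. *)
Lemma minor_edges N (e : N = n) (w : {ffun 'I_N -> 'I_n.+1}) :
  minor (dlam_mx (fun i => edge v (cast_ord e i))) w =
  \sum_q sort_sign C (concat [ffun _ : 'I_1 => q] w).
Proof.
subst N; under [in LHS]eq_fun do rewrite cast_ord_id.
pose y : 'cV[C]_n.+1 := \col_i (i == ord0)%:R.
have y1 : \sum_i y i 0 = 1.
  rewrite (bigD1 ord0)//= mxE eqxx big1 ?addr0// => q /negbTE q0.
  by rewrite mxE q0.
rewrite (minor_border w y1); last by move=> j; exact/dlam_mx_sum0/tangent_edge.
apply: eq_bigr => q _; set w' := concat _ _; rewrite minor_sort.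
have [/injectiveP wI|/injectivePn[i [j ij wij]]] := boolP (injectiveb w').
  have -> : im w' = [set: 'I_n.+1].
    apply/eqP; rewrite eqEcard finset.subsetT (card_im wI) cardsT card_ord.
    exact: leqnn.
  by rewrite det_edges mulr1.
by rewrite (sort_sign_repeat _ ij wij) mul0r.
Qed.

Lemma whitneyE l B x u : #|B| = l.+1 ->
  whitney lam (incr l.+1 B) x u = \sum_(p in B)
    sg1 C p (B :\ p) * (lam p x)%:C%C * minor (dlam_mx u) (incr l (B :\ p)).
Proof.
move=> Bl; rewrite /whitney dform_sumE im_incr//; apply: eq_bigr => p pB.
rewrite /smul /del im_incr// dlamE eps1_incr//.
by apply/eqP; rewrite -eqSS -Bl (cardsD1 p B) pB.
Qed.

(** The form phi_T is the volume form: each facet minor is the sign of its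
    omitted index, and the barycentric coordinates add up to 1. *)
Lemma whitney_vol x : simplex v x -> whitney lam (rhoT n) x (edge v) = 1.
Proof.
move=> xT; have -> : rhoT n = incr n.+1 [set: 'I_n.+1].
  rewrite -[LHS]Sigma_incr; last by apply/SigmaP => i j; rewrite !ffunE.
  congr incr; apply/setP => i; rewrite inE; apply/imsetP.
  by exists i; rewrite ?ffunE.
rewrite whitneyE ?cardsT ?card_ord// -[RHS](rmorph1 (real_complex R)).
rewrite -(lam_simplex_sum xT) rmorph_sum.
apply: eq_big => [p|p _]; first by rewrite inE.
set A := [set: _] :\ p.
have An : #|A| = n by have := cardsD1 p [set: 'I_n.+1]; rewrite cardsT card_ord inE => -[].
have := minor_edges (erefl n) (incr n A).
under [in X in X -> _]eq_fun do rewrite cast_ord_id.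
move=> ->; rewrite (bigD1 p)//= big1 ?addr0 => [|q qp].
  rewrite -[sort_sign _ _]/(eps1 C p (incr n A)) eps1_incr// mulrAC sg1_sqr ?mul1r//.
  by rewrite !inE eqxx.
by rewrite -[sort_sign _ _]/(eps1 C q (incr n A)) eps1_incr// sg1_eq0// !inE qp.
Qed.

End barycentric_forms.

(** * Integration over the standard simplex *)

Section tuple_integral.
Context (R : realType).
Local Notation mR := (measurableTypeR R).
Local Open Scope classical_set_scope.

Definition box n (c : n.-tuple mR) (d : R) : set (n.-tuple mR) :=
  [set t | forall j, (tnth c j : R) - d <= tnth t j <= tnth c j + d].

Lemma measurable_box n (c : n.-tuple mR) d : measurable (box c d).
Proof.
have -> : box c d = \bigcap_(j in [set: 'I_n])
    (fun t : n.-tuple mR => tnth t j) @^-1` `[(tnth c j : R) - d, tnth c j + d].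
  apply/seteqP; split=> t /=; first by move=> H j _ /=; rewrite in_itv/=.
  by move=> H j; have := H j Logic.I; rewrite /= in_itv.
apply: fin_bigcap_measurable; first exact: finite_finset.
move=> j _; rewrite -[X in measurable X]setTI.
by apply: measurable_tnth => //; exact: measurable_itv.
Qed.

(** The measure is built one coordinate at a time, so that cubes have the expected
    volume by induction on the dimension. *)
Lemma lebesgue_box n (c : n.-tuple mR) d : 0 <= d ->
  lebesgue_tuple R n (box c d) = ((2 * d) ^+ n)%:E.
Proof.
move=> d0; elim: n c => [|n IHn] c.
  have -> : box c d = setT by apply/seteqP; split=> // t _ [].
  by rewrite expr0 /= diracT.
rewrite /= /cons_measure /pushforward.
have -> : @tuple_cons R n @^-1` box c d =
    `[(thead c : R) - d, thead c + d] `*` box [tuple of behead c] d.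
  apply/seteqP; split=> -[x t] /=.
    move=> H; split; first by have := H ord0; rewrite in_itv/= [c in tnth c _]tuple_eta.
    move=> j; have := H (lift ord0 j).
    by rewrite [c in tnth c]tuple_eta !tnthS.
  move=> [H1 H2] j; rewrite [c in tnth c _]tuple_eta.
  case: (unliftP ord0 j) => [i ->|->]; last by move: H1; rewrite in_itv.
  by have := H2 i; rewrite !tnthS.
rewrite product_measure1E; [|exact: measurable_itv|exact: measurable_box].
rewrite IHn exprS EFinM; congr (_ * _)%E.
rewrite [LHS](lebesgue_measure_itv `[(thead c : R) - d, thead c + d]%R)/=.
rewrite lte_fin -EFinD; case: ltP => [_|]; first by congr EFin; ring.
move=> H; have d00 : d = 0 by lra.
by rewrite d00 mulr0.
Qed.

Context (n : nat).
Local Notation D := (@std_simplex R n).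
Local Notation mu := (@lebesgue_tuple R n).
Implicit Types (f g : n.-tuple mR -> R) (t : n.-tuple mR).

Lemma measurable_coord j : measurable_fun setT (fun t => tnth t j : R).
Proof. exact: measurable_tnth. Qed.

Lemma measurable_std_simplex : measurable D.
Proof.
have -> : D = (\bigcap_(j in [set: 'I_n]) (fun t => tnth t j) @^-1` `[0, +oo[) `&`
    (fun t => \sum_j tnth t j : R) @^-1` `]-oo, 1].
  apply/seteqP; split=> t /= [t0 t1]; split.
  - by move=> j _; rewrite /= in_itv/= t0.
  - by rewrite in_itv/=.
  - by move=> j; have := t0 j Logic.I; rewrite /= in_itv/= andbT.
  - by move: t1; rewrite in_itv/=.
apply: measurableI.
  apply: fin_bigcap_measurable; first exact: finite_finset.
  move=> j _; rewrite -[X in measurable X]setTI.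
  by apply: measurable_coord => //; exact: measurable_itv.
rewrite -[X in measurable X]setTI; apply: measurable_sum.
- by move=> j; exact: measurable_coord.
- exact: measurableT.
- exact: measurable_itv.
Qed.

Lemma std_simplex_le1 t j : D t -> 0 <= tnth t j <= 1.
Proof.
move=> [t0 t1]; rewrite t0/=; apply: le_trans t1.
by rewrite (bigD1 j)//= lerDl sumr_ge0.
Qed.

Lemma finite_std_simplex : (mu D < +oo)%E.
Proof.
pose c : n.-tuple mR := [tuple 0 | _ < n].
apply: (@le_lt_trans _ _ (mu (box c 1))).
  apply: le_measure; rewrite ?inE; [exact: measurable_std_simplex|exact: measurable_box|].
  move=> t Dt j; have := std_simplex_le1 j Dt; rewrite tnth_mktuple; lra.
by rewrite lebesgue_box ?ltry.
Qed.

(** All integrands are polynomials in the coordinates, and these are measurable,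
    bounded and Lipschitz on the simplex. The three properties together are
    closed under the ring operations; boundedness gives integrability, and the
    Lipschitz bound replaces continuity in passing from a vanishing integral to
    pointwise vanishing. *)
Definition tame f : Prop := measurable_fun setT f /\ exists2 M : R, 0 <= M &
  (forall t, D t -> `|f t| <= M) /\
  (forall t s d, D t -> D s -> (forall j, `|(tnth t j : R) - tnth s j| <= d) -> 0 <= d ->
     `|f t - f s| <= M * d).

Lemma tame_cst (a : R) : tame (fun=> a).
Proof.
split; first exact: measurable_cst.
exists `|a| => //; split=> // t s d _ _ _ d0.
by rewrite subrr normr0 mulr_ge0.
Qed.

Lemma tame_coord j : tame (fun t => tnth t j).
Proof.
split; first exact: measurable_coord.
exists 1 => //; split=> [t Dt|t s d _ _ H _]; last by rewrite mul1r.
by have /andP[t0 t1] := std_simplex_le1 j Dt; rewrite ger0_norm.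
Qed.

Lemma tameD f g : tame f -> tame g -> tame (fun t => f t + g t).
Proof.
move=> [mf [M M0 [fM fL]]] [mg [N N0 [gN gL]]]; split; first exact: measurable_realfun.measurable_funD.
exists (M + N); first exact: addr_ge0.
split=> [t Dt|t s d Dt Ds ts d0].
  by rewrite (le_trans (ler_normD _ _))// lerD ?fM ?gN.
rewrite opprD addrACA mulrDl (le_trans (ler_normD _ _))//.
by rewrite lerD ?fL ?gL.
Qed.

Lemma tameM f g : tame f -> tame g -> tame (fun t => f t * g t).
Proof.
move=> [mf [M M0 [fM fL]]] [mg [N N0 [gN gL]]]; split; first exact: measurable_realfun.measurable_funM.
exists (M * N + M * N); first by rewrite addr_ge0// mulr_ge0.
have MN0 : 0 <= M * N by rewrite mulr_ge0.
split=> [t Dt|t s d Dt Ds ts d0].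
  rewrite normrM (@le_trans _ _ (M * N))// ?lerDl//.
  by apply: ler_pM; rewrite ?fM ?gN.
have -> : f t * g t - f s * g s = f t * (g t - g s) + (f t - f s) * g s by ring.
rewrite (le_trans (ler_normD _ _))// !normrM mulrDl lerD//.
  by rewrite -mulrA ler_pM ?fM ?gL.
by rewrite mulrAC ler_pM ?gN ?fL.
Qed.

Lemma tame_sum (I : Type) (r : seq I) (P : pred I) (F : I -> n.-tuple mR -> R) :
  (forall i, tame (F i)) -> tame (fun t => \sum_(i <- r | P i) F i t).
Proof.
move=> FT; elim: r => [|i r IHr].
  by under eq_fun do rewrite big_nil; exact: tame_cst.
under eq_fun do rewrite big_cons; case: (P i) => //.
exact: tameD.
Qed.

Lemma tame_prod (I : Type) (r : seq I) (P : pred I) (F : I -> n.-tuple mR -> R) :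
  (forall i, tame (F i)) -> tame (fun t => \prod_(i <- r | P i) F i t).
Proof.
move=> FT; elim: r => [|i r IHr].
  by under eq_fun do rewrite big_nil; exact: tame_cst.
under eq_fun do rewrite big_cons; case: (P i) => //.
exact: tameM.
Qed.

Lemma tameN f : tame f -> tame (fun t => - f t).
Proof.
by move=> fT; under eq_fun do rewrite -mulN1r; apply: tameM => //; exact: tame_cst.
Qed.

Lemma tameX f k : tame f -> tame (fun t => f t ^+ k).
Proof.
move=> fT; elim: k => [|k IHk]; first exact: tame_cst.
by under eq_fun do rewrite exprS; exact: tameM.
Qed.

Lemma tame_integrable f : tame f -> mu.-integrable D (EFin \o f).
Proof.
move=> [mf [M M0 [fM _]]]; apply: measurable_bounded_integrable.
- exact: measurable_std_simplex.
- exact: finite_std_simplex.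
- exact: measurable_funTS.
- exists M; split; first exact: num_real.
  by move=> y My t Dt; rewrite /= (le_trans (fM _ Dt))// ltW.
Qed.

(** Positivity of f at an interior point propagates to a small box around it, on
    which the integral is bounded below. *)
Lemma tame_integral_eq0 f : tame f -> (forall t, D t -> 0 <= f t) ->
  \int[mu]_(t in D) f t = 0 ->
  forall t, (forall j, 0 < (tnth t j : R)) -> \sum_j tnth t j < 1 -> f t = 0.
Proof.
move=> fT f0 If t t0 t1.
have Dt : D t by split=> [j|]; exact: ltW.
have [mf [M M0 [_ fL]]] := fT.
apply/eqP; rewrite eq_le f0// andbT leNgt; apply/negP => ft0.
pose b := \big[Order.min/1]_j (tnth t j : R).
have b0 : 0 < b by apply: lt_bigmin => // j _; exact: t0.
pose e := (1 - \sum_j tnth t j) / n.+1%:R.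
have e0 : 0 < e by rewrite divr_gt0// ?subr_gt0// ltr0n.
(* A box of half-width at most h keeps f above f t / 2, by the Lipschitz bound M;
   b and e keep the box inside the simplex. *)
pose h := f t / (2 * (M + 1)).
have h0 : 0 < h by rewrite divr_gt0// mulr_gt0// ltr_pwDr.
pose d := Order.min b (Order.min e h).
have d0 : 0 < d by rewrite !lt_min b0 e0 h0.
have db j : d <= tnth t j by rewrite ge_min bigmin_le_cond.
have de : d <= e by rewrite !ge_min lexx orbT.
have dh : d <= h by rewrite !ge_min lexx !orbT.
have near_t s j : box t d s -> `|(tnth s j : R) - tnth t j| <= d.
  by move=> /(_ j); rewrite -ler_distl.
have boxD : box t d `<=` D.
  move=> s sB; split=> [j|].
    by have := sB j => /andP[+ _]; apply: le_trans; rewrite subr_ge0.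
  apply: (@le_trans _ _ (\sum_j (tnth t j + d : R))).
    by apply: ler_sum => j _; have := sB j => /andP[].
  rewrite big_split/= sumr_const card_ord -lerBrDl -mulr_natl.
  have : d * n.+1%:R <= 1 - \sum_j tnth t j by rewrite -ler_pdivlMr// ltr0n.
  by apply: le_trans; rewrite mulrC ler_wpM2l ?ler_nat// ltW.
have fbox s : box t d s -> f t / 2 <= f s.
  move=> sB; have := fL s t d (boxD _ sB) Dt (fun j => near_t s j sB) (ltW d0).
  rewrite ler_norml => /andP[+ _].
  have : M * d <= f t / 2.
    apply: (@le_trans _ _ (M * h)); first by rewrite ler_wpM2l.
    rewrite /h invfM mulrA mulrA [M * _]mulrC -!mulrA ler_pM2l// mulrCA.
    rewrite ler_piMr ?invr_ge0// ler_pdivrMr ?mul1r ?lerDl// ltr_pwDr//.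
  lra.
suff : (0 < \int[mu]_(t in D) f t)%R by rewrite If ltxx.
have Iint := tame_integrable fT.
have Ifin : (\int[mu]_(t in D) (f t)%:E)%E \is a fin_num.
  by apply: integrable_fin_num Iint; exact: measurable_std_simplex.
rewrite /Rintegral -lte_fin fineK//.
apply: (@lt_le_trans _ _ (\int[mu]_(s in box t d) (f t / 2)%:E)%E).
  rewrite integral_cst; last exact: measurable_box.
  rewrite [X in (_ * X)%E](_ : _ = ((2 * d) ^+ n)%:E); last exact/lebesgue_box/ltW.
  rewrite -EFinM lte_fin mulr_gt0//.
    by rewrite divr_gt0.
  by rewrite exprn_gt0// mulr_gt0.
apply: (@le_trans _ _ (\int[mu]_(s in box t d) (f s)%:E)%E).
  apply: ge0_le_integral; first exact: measurable_box.
  - by move=> s _; rewrite lee_fin ltW// divr_gt0.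
  - exact: measurable_cst.
  - by apply/measurable_realfun.measurable_EFinP; exact: measurable_funTS.
  - by move=> s sB; rewrite lee_fin fbox.
apply: ge0_subset_integral => //.
- exact: measurable_box.
- exact: measurable_std_simplex.
- by apply/measurable_realfun.measurable_EFinP; exact: measurable_funTS.
Qed.

Local Notation C := R[i].
Implicit Types F G : n.-tuple mR -> C.

Definition ctame F : Prop :=
  tame (fun t => complex.Re (F t)) /\ tame (fun t => complex.Im (F t)).

Definition cintegral F : C :=
  (\int[mu]_(t in D) complex.Re (F t) +i* \int[mu]_(t in D) complex.Im (F t))%C.

Lemma ctame_real f : tame f -> ctame (fun t => (f t)%:C%C).
Proof. by move=> fT; split=> //=; exact: tame_cst. Qed.

Lemma ctame_cst (a : C) : ctame (fun=> a).
Proof. by split; exact: tame_cst. Qed.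

Lemma ctameD F G : ctame F -> ctame G -> ctame (fun t => F t + G t).
Proof.
move=> [F1 F2] [G1 G2]; split.
  by under eq_fun do rewrite raddfD/=; exact: tameD.
by under eq_fun do rewrite raddfD/=; exact: tameD.
Qed.

Lemma ctameM F G : ctame F -> ctame G -> ctame (fun t => F t * G t).
Proof.
have ReM (x y : C) : complex.Re (x * y) =
  complex.Re x * complex.Re y + - (complex.Im x * complex.Im y) by case: x; case: y.
have ImM (x y : C) : complex.Im (x * y) =
  complex.Re x * complex.Im y + complex.Im x * complex.Re y by case: x; case: y.
move=> [F1 F2] [G1 G2]; split.
  under eq_fun do rewrite ReM.
  by apply: tameD; [exact: tameM|apply: tameN; exact: tameM].
under eq_fun do rewrite ImM.
by apply: tameD; exact: tameM.
Qed.

Lemma ctame_conj F : ctame F -> ctame (fun t => (F t)^*).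
Proof.
move=> [F1 F2]; split=> /=.
  have -> : (fun t => complex.Re (F t)^*) = fun t => complex.Re (F t).
    by apply/funext => t; case: (F t).
  exact: F1.
have -> : (fun t => complex.Im (F t)^*) = fun t => - complex.Im (F t).
  by apply/funext => t; case: (F t).
exact: tameN.
Qed.

Lemma ctame_sum (I : Type) (r : seq I) (P : pred I) (F : I -> n.-tuple mR -> C) :
  (forall i, ctame (F i)) -> ctame (fun t => \sum_(i <- r | P i) F i t).
Proof.
move=> FT; elim: r => [|i r IHr].
  by under eq_fun do rewrite big_nil; exact: ctame_cst.
under eq_fun do rewrite big_cons; case: (P i) => //.
exact: ctameD.
Qed.

Lemma eq_cintegral F G : (forall t, D t -> F t = G t) -> cintegral F = cintegral G.
Proof.
move=> FG; rewrite /cintegral; congr (_ +i* _)%C; apply: eq_Rintegral => t;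
by rewrite inE => /FG ->.
Qed.

Lemma cintegral0 : cintegral (fun=> 0) = 0.
Proof. by rewrite /cintegral/= !Rintegral_cst ?mul0r//; exact: measurable_std_simplex. Qed.

Lemma cintegralD F G : ctame F -> ctame G ->
  cintegral (fun t => F t + G t) = cintegral F + cintegral G.
Proof.
move=> [F1 F2] [G1 G2]; rewrite /cintegral.
under eq_Rintegral do rewrite raddfD/=.
under [X in (_ +i* X)%C]eq_Rintegral do rewrite raddfD/=.
by rewrite !RintegralD//; try exact: tame_integrable; exact: measurable_std_simplex.
Qed.

Lemma cintegral_sum (I : Type) (r : seq I) (P : pred I) (F : I -> n.-tuple mR -> C) :
  (forall i, ctame (F i)) ->
  cintegral (fun t => \sum_(i <- r | P i) F i t) = \sum_(i <- r | P i) cintegral (F i).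
Proof.
move=> FT; elim: r => [|i r IHr].
  by rewrite big_nil; under eq_fun do rewrite big_nil; exact: cintegral0.
rewrite big_cons; under eq_fun do rewrite big_cons; case: (P i) => //.
by rewrite cintegralD ?IHr//; exact: ctame_sum.
Qed.

Lemma cintegral_sign k F : ctame F ->
  cintegral (fun t => (-1) ^+ k * F t) = (-1) ^+ k * cintegral F.
Proof.
move=> FT; rewrite -signr_odd; case: (odd k); last first.
  by rewrite expr0 mul1r; congr cintegral; apply/funext => t; rewrite mul1r.
apply/eqP; rewrite expr1 mulN1r -addr_eq0 -cintegralD//; last first.
  by apply: ctameM => //; exact: ctame_cst.
rewrite -[X in _ == X]cintegral0; apply/eqP/eq_cintegral => t _.
by rewrite mulN1r addNr.
Qed.

Lemma cintegral_eq0 F : ctame F -> (forall t, D t -> 0 <= F t) -> cintegral F = 0 ->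
  forall t, (forall j, 0 < (tnth t j : R)) -> \sum_j tnth t j < 1 -> F t = 0.
Proof.
move=> [F1 F2] F0 [I1 _] t t0 t1.
have Dt : D t by split=> [j|]; exact: ltW.
have ReF0 s : D s -> 0 <= complex.Re (F s).
  by move=> /F0; case: (F s) => a b; rewrite lecE/= => /andP[].
have := tame_integral_eq0 F1 ReF0 I1 t0 t1.
by have := F0 t Dt; case: (F t) => a b; rewrite lecE/= => /andP[/eqP -> _] ->.
Qed.

End tuple_integral.

(** * Independence of monomials on the simplex *)

(** Uniqueness of base b + 1 expansions, by reduction modulo b + 1. *)
Lemma digits_inj N b (a c : 'I_N -> 'I_b.+1) :
  (\sum_(i < N) a i * b.+1 ^ i = \sum_(i < N) c i * b.+1 ^ i)%N -> a =1 c.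
Proof.
elim: N a c => [|N IHN] a c; first by move=> _ [].
rewrite !big_ord_recl !expn0 !muln1.
have shift (d : 'I_N.+1 -> 'I_b.+1) : (\sum_(i < N) d (lift ord0 i) * b.+1 ^ lift ord0 i =
    (\sum_(i < N) d (lift ord0 i) * b.+1 ^ i) * b.+1)%N.
  by rewrite big_distrl; apply: eq_bigr => i _; rewrite lift0 expnSr mulnA.
rewrite !shift => E.
have E0 : a ord0 = c ord0.
  apply: val_inj; move: (congr1 (modn^~ b.+1) E).
  by rewrite /= ![(_ + _ * b.+1)%N]addnC !modnMDl !modn_small.
move: E; rewrite E0 => /addnI/eqP; rewrite eqn_pmul2r// => /eqP/IHN E.
by move=> i; case: (unliftP ord0 i) => [j ->|->//]; exact: E.
Qed.

(** Kronecker substitution: with the coordinates proportional to z ^ (r + 1) ^ i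
    distinct monomials of degree r become distinct powers of z, and a univariate
    polynomial that vanishes at all positive integers z is zero. *)
Lemma monomials_free (R : realType) (n r : nat)
    (c : {ffun 'I_n.+1 -> 'I_r.+1} -> R[i]) :
  (forall l : 'I_n.+1 -> R, (forall i, 0 < l i) -> \sum_i l i = 1 ->
    \sum_(a in multi_index r n) (\prod_i l i ^+ a i)%:C%C * c a = 0) ->
  forall a, a \in multi_index r n -> c a = 0.
Proof.
move=> H a aMI.
pose e (a : {ffun 'I_n.+1 -> 'I_r.+1}) := (\sum_i a i * r.+1 ^ i)%N.
pose p : {poly R[i]} := \sum_(a in multi_index r n) c a *: 'X^(e a).
have proot (z : nat) : (0 < z)%N -> root p z%:R.
  move=> z0; pose Z : R := \sum_(i < n.+1) z%:R ^+ (r.+1 ^ i).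
  have Z0 : 0 < Z.
    rewrite /Z big_ord_recl ltr_pwDl ?exprn_gt0 ?ltr0n// sumr_ge0//.
  have l0 i : 0 < z%:R ^+ (r.+1 ^ i) / Z by rewrite divr_gt0// exprn_gt0// ltr0n.
  have l1 : \sum_(i < n.+1) z%:R ^+ (r.+1 ^ i) / Z = 1.
    by rewrite -mulr_suml divff// gt_eqF.
  have := congr1 (fun y => (Z ^+ r)%:C%C * y) (H _ l0 l1).
  rewrite mulr0 mulr_sumr => E.
  rewrite /root /p horner_sum -[X in _ == X]E.
  apply/eqP/eq_bigr => b bMI; rewrite hornerZ hornerXn mulrA -rmorphM/= mulrC.
    congr (_ * _); under eq_bigr do rewrite expr_div_n.
    rewrite prodf_div prodrXr/=.
    move: bMI; rewrite inE => /eqP ->.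
    rewrite mulrCA mulfV ?mulr1 ?expf_neq0 ?gt_eqF//.
    under eq_bigr do rewrite -exprM mulnC; rewrite prodrXr.
    by rewrite rmorphXn/= rmorph_nat.
have p0 : p = 0.
  apply/eqP/negPn/negP => pN0.
  have /(max_poly_roots pN0) : all (root p) [seq i.+1%:R : R[i] | i <- iota 0 (size p)].
    by apply/allP => _ /mapP[i _ ->]; exact: proot.
  rewrite size_map size_iota ltnn => H'; suff /H' : uniq
    [seq i.+1%:R : R[i] | i <- iota 0 (size p)] by [].
  rewrite map_inj_uniq ?iota_uniq// => i j /eqP.
  by rewrite eqr_nat eqSS => /eqP.
have : p`_(e a) = 0 by rewrite p0 coef0.
rewrite /p coef_sum (bigD1 a)//= coefZ coefXn eqxx mulr1 big1 ?addr0// => b /andP[_ ba].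
rewrite coefZ coefXn; case: eqP => [eab|]; last by rewrite mulr0.
by case/eqP: ba; apply/ffunP => i; rewrite (digits_inj eab).
Qed.

(** * The identity at a fixed point *)

Section wedge_identity.
Context (R : realType) (m n k : nat) (hk : (k <= n)%N).
Context (v : 'I_n.+1 -> 'rV[R]_m).
Context (lam : 'I_n.+1 -> 'rV[R]_m -> R) (hlam : barycentric v lam).
Local Notation V := 'rV[R]_m.
Local Notation C := R[i].
Implicit Types (A B : {set 'I_n.+1}) (x : V).

Let lamC x i : C := (lam i x)%:C%C.

Lemma card_compl A : #|A| = k -> #|~: A| = (n - k).+1.
Proof.
move=> Ak; apply/eqP; rewrite -(eqn_add2l #|A|) cardsC card_ord Ak.
by rewrite addnS subnKC.
Qed.

Lemma card_compl1 B : #|B| = k.+1 -> #|~: B| = (n - k)%N.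
Proof.
move=> Bk; apply/eqP; rewrite -(eqn_add2l #|B|) cardsC card_ord Bk.
by rewrite addSn subnKC.
Qed.

Lemma compl_incr A : #|A| = k -> compl (incr k A) = incr (n - k).+1 (~: A).
Proof. by move=> Ak; rewrite /compl im_incr. Qed.

Lemma lam_prod_incr l A x : #|A| = l ->
  lam_prod lam (incr l A) x = \prod_(i in A) lamC x i.
Proof. by move=> Al; rewrite /lam_prod rmorph_prod -(prod_incr (lamC x) Al). Qed.

Lemma sum_wedge_conj (w : {set 'I_n.+1} -> C) B :
  sum_wedge (fun A => (w A)^*) B = (sum_wedge w B)^*.
Proof.
rewrite /sum_wedge rmorph_sum; apply: eq_bigr => p _; rewrite rmorphM; congr (_ * _).
by rewrite /sg1 rmorph_prod; apply: eq_bigr => j _; rewrite /osg rmorph_int.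
Qed.

Lemma wedge_dlam_edges A B x : #|A| = k -> #|B| = (n - k)%N ->
  wedge (dlam lam (incr k A)) (dlam lam (incr (n - k) B)) x
    (fun i => edge v (cast_ord (subnKC hk) i)) =
  \sum_q sgs C A B * (sg1 C q A * sg1 C q B).
Proof.
move=> Ak Bk; rewrite (wedge_dlam hlam) (minor_edges hlam); apply: eq_bigr => q _.
rewrite sort_sign_cons -[sort_sign _ _]/(eps C (incr k A) (incr (n - k) B)).
rewrite eps_incr//; congr (_ * _); rewrite big_split_ord/=.
rewrite /sg1 -(prod_incr (fun j => osg C q j) Ak) -(prod_incr (fun j => osg C q j) Bk).
by congr (_ * _); apply: eq_bigr => i _; rewrite ?concat_l ?concat_r.
Qed.

(** Evaluation on the edges pairs the form with the complementary differentials,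
    which extracts single components of the product with the sum of all basis
    covectors. *)
Lemma sum_wedge_dlam (w : {set 'I_n.+1} -> C) B x : #|B| = k.+1 ->
  \sum_(A : {set 'I_n.+1} | #|A| == k) w A *
    wedge (dlam lam (incr k A)) (dlam lam (incr (n - k) (~: B))) x
      (fun i => edge v (cast_ord (subnKC hk) i)) =
  sgs C B (~: B) * sum_wedge w B.
Proof.
move=> Bk; rewrite -(sum_wedge_compl w Bk); apply: eq_bigr => A /eqP Ak.
by rewrite wedge_dlam_edges// card_compl1.
Qed.

Lemma sum_whitney_form (w : {set 'I_n.+1} -> C) x u :
  \sum_(A : {set 'I_n.+1} | #|A| == k) sgs C A (~: A) * w A *
    (\prod_(i in A) lamC x i) * whitney lam (incr (n - k).+1 (~: A)) x u =
  (-1) ^+ k * \sum_(B : {set 'I_n.+1} | #|B| == k.+1)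
    (\prod_(i in B) lamC x i) * sgs C B (~: B) * sum_wedge w B *
    dlam lam (incr (n - k) (~: B)) x u.
Proof.
rewrite -(sum_whitney k (lamC x) w (fun T => dlam lam (incr (n - k) T) x u)).
apply: eq_bigr => A /eqP Ak; congr (_ * _); rewrite (whitneyE hlam) ?card_compl//.
by apply: eq_bigr => p _; rewrite (dlamE hlam).
Qed.

Lemma wedge_whitney_form (w : {set 'I_n.+1} -> C) j (s : {ffun 'I_j -> 'I_n.+1}) x u :
  \sum_(A : {set 'I_n.+1} | #|A| == k) sgs C A (~: A) * w A *
    (\prod_(i in A) lamC x i) *
    wedge (dlam lam s) (whitney lam (incr (n - k).+1 (~: A))) x u =
  (-1) ^+ k * \sum_(B : {set 'I_n.+1} | #|B| == k.+1)
    (\prod_(i in B) lamC x i) * sgs C B (~: B) * sum_wedge w B *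
    wedge (dlam lam s) (dlam lam (incr (n - k) (~: B))) x u.
Proof.
rewrite -(sum_whitney k (lamC x) w
  (fun T => wedge (dlam lam s) (dlam lam (incr (n - k) T)) x u)).
apply: eq_bigr => A /eqP Ak; congr (_ * _).
rewrite /whitney wedge_sumr im_incr ?card_compl//; apply: eq_bigr => p pA.
rewrite wedge_smulr /del im_incr ?card_compl// eps1_incr//=.
by apply/eqP; rewrite -eqSS -(card_compl Ak) (cardsD1 p (~: A)) pA.
Qed.

(** Duality turns the second factor into components of the conjugate of sum_wedge w,
    and pairing with the first factor yields the same components of sum_wedge w;
    the sign of B and its complement occurs twice and cancels. *)
Lemma pointwise_identity (w : {set 'I_n.+1} -> C) x :
  \sum_(A : {set 'I_n.+1} | #|A| == k) \sum_(A' : {set 'I_n.+1} | #|A'| == k)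
    w A * (sgs C A' (~: A') * (w A')^* * (\prod_(i in A') lamC x i) *
    wedge (dlam lam (incr k A)) (whitney lam (incr (n - k).+1 (~: A'))) x
      (fun i => edge v (cast_ord (subnKC hk) i))) =
  (-1) ^+ k * \sum_(B : {set 'I_n.+1} | #|B| == k.+1)
    (\prod_(i in B) lamC x i) * `|sum_wedge w B| ^+ 2.
Proof.
under eq_bigr do rewrite -mulr_sumr (wedge_whitney_form (fun A => (w A)^*)) mulrCA mulr_sumr.
rewrite -mulr_sumr exchange_big; congr (_ * _); apply: eq_bigr => B /eqP Bk.
rewrite normCK sum_wedge_conj.
transitivity ((\prod_(i in B) lamC x i) * sgs C B (~: B) * (sum_wedge w B)^* *
  (sgs C B (~: B) * sum_wedge w B)); last first.
  transitivity ((\prod_(i in B) lamC x i) * (sum_wedge w B * (sum_wedge w B)^*) *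
    (sgs C B (~: B) * sgs C B (~: B))); first by ring.
  by rewrite sgs_compl_sqr mulr1.
rewrite -(sum_wedge_dlam w x Bk) mulr_sumr; apply: eq_bigr => A _.
by rewrite mulrCA.
Qed.

(** Bordering by a vertex turns minors of size k into minors of size k + 1, in
    which the form appears multiplied by the sum of all basis covectors. *)
Lemma sum_dlam_border (w : {set 'I_n.+1} -> C) x u : (forall i, tangent v (u i)) ->
  \sum_(A : {set 'I_n.+1} | #|A| == k) w A * dlam lam (incr k A) x u =
  \sum_(B : {set 'I_n.+1} | #|B| == k.+1) sum_wedge w B *
    minor (row_mx (\col_i (i == ord0)%:R) (dlam_mx lam u)) (incr k.+1 B).
Proof.
move=> uT; pose y : 'cV[C]_n.+1 := \col_i (i == ord0)%:R.
have y1 : \sum_i y i 0 = 1.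
  rewrite (bigD1 ord0)//= mxE eqxx big1 ?addr0// => q /negbTE q0.
  by rewrite mxE q0.
pose E B := minor (row_mx y (dlam_mx lam u)) (incr k.+1 B).
transitivity (\sum_(A : {set 'I_n.+1} | #|A| == k) \sum_(q | q \notin A)
    sg1 C q A * w A * E (q |: A)).
  apply: eq_bigr => A /eqP Ak; rewrite (dlamE hlam).
  rewrite (minor_border _ y1); last by move=> j; exact: (dlam_mx_sum0 hlam).
  rewrite mulr_sumr [RHS]big_mkcond; apply: eq_bigr => q _.
  rewrite minor_sort -[sort_sign _ _]/(eps1 C q (incr k A)) eps1_incr//.
  case: ifPn => [qA|/negPn qA]; last by rewrite sg1_eq0// mul0r mulr0.
  rewrite mulrCA mulrA; congr (_ * minor _ (incr _ _)).
  rewrite im_concat im_incr//; congr (_ :|: _)%SET.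
  apply/setP => i; rewrite inE; apply/imsetP/eqP => [[j _ ->]|->]; rewrite ?ffunE//.
  by exists ord0; rewrite ?ffunE.
rewrite sum_flag; apply: eq_bigr => B _; rewrite /sum_wedge mulr_suml.
by apply: eq_bigr => p pB; rewrite finset.setD1K.
Qed.

End wedge_identity.

(** * The integrands and the four conditions *)

Section tame_forms.
Context (R : realType) (m n : nat) (v : 'I_n.+1 -> 'rV[R]_m).
Context (lam : 'I_n.+1 -> 'rV[R]_m -> R) (hlam : barycentric v lam).
Local Notation V := 'rV[R]_m.
Local Notation C := R[i].

Lemma tame_lam i : tame (fun t => lam i (param v t)).
Proof.
under eq_fun do rewrite (lam_param hlam).
case: unlift => [j|] /=; first exact: tame_coord.
apply: tameD; first exact: tame_cst.
by apply: tameN; apply: tame_sum => j; exact: tame_coord.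
Qed.

Lemma ctame_lam_pow r (a : {ffun 'I_n.+1 -> 'I_r.+1}) :
  ctame (fun t => lam_pow lam a (param v t)).
Proof. by apply/ctame_real/tame_prod => i; exact/tameX/tame_lam. Qed.

Lemma ctame_lam_prod k (s : {ffun 'I_k -> 'I_n.+1}) :
  ctame (fun t => lam_prod lam s (param v t)).
Proof. by apply/ctame_real/tame_prod => i; exact: tame_lam. Qed.

Lemma ctame_whitney l (s : {ffun 'I_l.+1 -> 'I_n.+1}) u :
  ctame (fun t => whitney lam s (param v t) u).
Proof.
under eq_fun do rewrite /whitney dform_sumE; apply: ctame_sum => p.
under eq_fun do rewrite /smul (dlamE hlam).
apply: ctameM; last exact: ctame_cst.
by apply: ctameM; [exact: ctame_cst|exact/ctame_real/tame_lam].
Qed.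

Lemma ctame_wedge_whitney k l (s : {ffun 'I_k -> 'I_n.+1})
    (w : {ffun 'I_l.+1 -> 'I_n.+1}) u :
  ctame (fun t => wedge (dlam lam s) (whitney lam w) (param v t) u).
Proof.
under eq_fun do rewrite /whitney wedge_sumr; apply: ctame_sum => p.
under eq_fun do rewrite wedge_smulr (wedge_dlam hlam).
apply: ctameM; last exact: ctame_cst.
by apply: ctameM; [exact: ctame_cst|exact/ctame_real/tame_lam].
Qed.

End tame_forms.

Lemma integral_formE (R : realType) (m n : nat) (v : 'I_n.+1 -> 'rV[R]_m) (o : bool)
    (w : dform R m n) :
  integral_form v o w = (-1) ^+ o * cintegral (fun t => w (param v t) (edge v)).
Proof. by []. Qed.

Section identity.
Context (R : realType) (n r m k : nat) (hk : (k <= n)%N).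
Context (v : 'I_n.+1 -> 'rV[R]_m) (o : bool).
Context (lam : 'I_n.+1 -> 'rV[R]_m -> R) (hlam : barycentric v lam).
Context (omega : {ffun 'I_n.+1 -> 'I_r.+1} -> {ffun 'I_k -> 'I_n.+1} -> R[i]).
Local Notation V := 'rV[R]_m.
Local Notation C := R[i].
Local Notation MI := (multi_index r n).
Implicit Types (A B : {set 'I_n.+1}) (x : V).

(** At a fixed point x the form of (a) has the constant coefficients coef x; its
    components after sum_wedge are polynomials in lam with coefficients wcoef. *)
Definition coef x A : C := \sum_(a in MI) omega a (incr k A) * lam_pow lam a x.
Definition wcoef a B : C := sum_wedge (fun A => omega a (incr k A)) B.

Definition density x : C := \sum_(B : {set 'I_n.+1} | #|B| == k.+1)
  (\prod_(i in B) (lam i x)%:C%C) * `|sum_wedge (coef x) B| ^+ 2.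

Lemma sum_wedge_coef x B :
  sum_wedge (coef x) B = \sum_(a in MI) lam_pow lam a x * wcoef a B.
Proof.
rewrite /sum_wedge /coef; under eq_bigr do rewrite mulr_sumr.
rewrite exchange_big; apply: eq_bigr => a _; rewrite mulr_sumr.
by apply: eq_bigr => p _; rewrite mulrCA mulrC -mulrA mulrCA.
Qed.

Lemma theta_sum B (f : {ffun 'I_n.+1 -> 'I_r.+1} -> C) : #|B| = k.+1 ->
  \sum_(a in MI) \sum_(p in im (incr k.+1 B))
    eps1 C p (del (incr k.+1 B) p) * f a * omega a (del (incr k.+1 B) p) =
  \sum_(a in MI) f a * wcoef a B.
Proof.
move=> Bk; apply: eq_bigr => a _; rewrite /wcoef /sum_wedge mulr_sumr im_incr//.
apply: eq_bigr => p pB; rewrite /del im_incr// eps1_incr ?mulrA; last first.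
  by apply/eqP; rewrite -eqSS -Bk (cardsD1 p B) pB.
by rewrite [f a * _]mulrC.
Qed.

Lemma cond_d_wcoef :
  (forall a theta, a \in MI -> theta \in Sigma k.+1 n ->
     \sum_(p in im theta) eps1 C p (del theta p) * omega a (del theta p) = 0) <->
  (forall a B, a \in MI -> #|B| = k.+1 -> wcoef a B = 0).
Proof.
have E a B : #|B| = k.+1 -> \sum_(p in im (incr k.+1 B))
    eps1 C p (del (incr k.+1 B) p) * omega a (del (incr k.+1 B) p) = wcoef a B.
  move=> Bk; rewrite /wcoef /sum_wedge im_incr//; apply: eq_bigr => p pB.
  rewrite /del im_incr// eps1_incr//.
  by apply/eqP; rewrite -eqSS -Bk (cardsD1 p B) pB.
split=> [H a B aMI Bk|H a s aMI sS]; first by rewrite -E// H// incr_Sigma.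
have sk : #|im s| = k.+1 by apply: card_im; exact: Sigma_inj sS.
by rewrite -(Sigma_incr sS) E// H.
Qed.

Lemma cond_c_wcoef :
  (forall a sigma, a \in MI -> sigma \in Sigma k n -> ord0 \notin im sigma ->
     omega a sigma - \sum_(p in im sigma)
       eps1 C p (del sigma p) * omega a (exch sigma p ord0) = 0) <->
  (forall a B, a \in MI -> #|B| = k.+1 -> wcoef a B = 0).
Proof.
have E a A : #|A| = k -> omega a (incr k A) - \sum_(p in im (incr k A))
    eps1 C p (del (incr k A) p) * omega a (exch (incr k A) p ord0) =
    omega a (incr k A) - \sum_(p in A)
      sg1 C p (A :\ p) * omega a (incr k (ord0 |: (A :\ p))).
  move=> Ak; congr (_ - _); rewrite im_incr//; apply: eq_bigr => p pA.
  rewrite /del /exch im_incr// eps1_incr//.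
  by apply/eqP; rewrite -Ak (cardsD1 p A) pA.
split=> [H a B aMI|H a s aMI sS s0].
  move: B; apply/(sum_wedge_eq0 k (fun A => omega a (incr k A))) => A Ak A0.
  by rewrite -E// H ?incr_Sigma ?im_incr.
have sk : #|im s| = k by apply: card_im; exact: Sigma_inj sS.
rewrite -(Sigma_incr sS) E//.
have [wedge0 _] := sum_wedge_eq0 k (fun A => omega a (incr k A)).
by apply: wedge0 => // B; exact: H.
Qed.

Lemma form_aE x u :
  (\sum_(a in MI) \sum_(sigma in Sigma k n)
     smul (fun x => omega a sigma * lam_pow lam a x) (dlam lam sigma)) x u =
  \sum_(A : {set 'I_n.+1} | #|A| == k) coef x A * dlam lam (incr k A) x u.
Proof.
rewrite dform_sumE; under eq_bigr do rewrite dform_sumE big_Sigma.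
by rewrite exchange_big; apply: eq_bigr => A _; rewrite /coef mulr_suml.
Qed.

(** This formula shows that (d) implies (b). *)
Lemma form_bE x u :
  (\sum_(a in MI) \sum_(sigma in Sigma k n)
     smul (fun x => eps C sigma (compl sigma) * omega a sigma *
                    lam_pow lam a x * lam_prod lam sigma x)
       (whitney lam (compl sigma))) x u =
  (-1) ^+ k * \sum_(B : {set 'I_n.+1} | #|B| == k.+1)
    (\prod_(i in B) (lam i x)%:C%C) * sgs C B (~: B) * sum_wedge (coef x) B *
    dlam lam (incr (n - k) (~: B)) x u.
Proof.
rewrite -(sum_whitney_form hk hlam) dform_sumE.
under eq_bigr do rewrite dform_sumE big_Sigma.
rewrite exchange_big; apply: eq_bigr => A /eqP Ak.
rewrite compl_incr// eps_incr ?(card_compl hk)// /coef.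
rewrite mulr_sumr !mulr_suml; apply: eq_bigr => a _.
by rewrite /smul lam_prod_incr// -!mulrA.
Qed.

(** Summing over multi-indices first leaves the pointwise identity for coef x. *)
Lemma sum_integrand x :
  \sum_(a in MI) \sum_(b in MI) \sum_(sigma in Sigma k n) \sum_(rho in Sigma k n)
    cast_form (subnKC hk) (wedge
      (smul (fun x => omega a sigma * lam_pow lam a x) (dlam lam sigma))
      (smul (fun x => eps C rho (compl rho) * (omega b rho)^* *
                      lam_pow lam b x * lam_prod lam rho x)
         (whitney lam (compl rho)))) x (edge v) =
  (-1) ^+ k * density x.
Proof.
rewrite /density -(pointwise_identity hk hlam (coef x) x).
under eq_bigr do rewrite exchange_big.
rewrite exchange_big big_Sigma; apply: eq_bigr => A /eqP Ak.
under eq_bigr do rewrite exchange_big.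
rewrite exchange_big big_Sigma; apply: eq_bigr => A' /eqP Ak'.
rewrite compl_incr// eps_incr ?(card_compl hk)// {1}/coef.
rewrite mulr_suml; apply: eq_bigr => a _.
have -> : (coef x A')^* = \sum_(b in MI) (omega b (incr k A'))^* * lam_pow lam b x.
  rewrite /coef rmorph_sum; apply: eq_bigr => b _; rewrite rmorphM; congr (_ * _).
  by apply/CrealP; rewrite /lam_pow complex_real.
rewrite mulr_sumr !mulr_suml mulr_sumr; apply: eq_bigr => b _.
by rewrite /cast_form wedge_smull wedge_smulr lam_prod_incr// -!mulrA.
Qed.

Lemma sum_theta_integrand x : simplex v x ->
  \sum_(theta in Sigma k.+1 n)
    smul (fun x => lam_prod lam theta x *
       `|\sum_(a in MI) \sum_(p in im theta)
           eps1 C p (del theta p) * lam_pow lam a x * omega a (del theta p)| ^+ 2)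
      (whitney lam (rhoT n)) x (edge v) = density x.
Proof.
move=> xT; rewrite big_Sigma; apply: eq_bigr => B /eqP Bk.
rewrite /smul (whitney_vol hlam)// mulr1 lam_prod_incr//.
by rewrite (theta_sum (fun a => lam_pow lam a x))// -sum_wedge_coef.
Qed.

End identity.

(** * Vanishing of the integral *)

Section vanishing.
Context (R : realType) (n r m k : nat) (v : 'I_n.+1 -> 'rV[R]_m).
Context (lam : 'I_n.+1 -> 'rV[R]_m -> R) (hlam : barycentric v lam).
Context (omega : {ffun 'I_n.+1 -> 'I_r.+1} -> {ffun 'I_k -> 'I_n.+1} -> R[i]).
Local Notation C := R[i].
Local Notation MI := (multi_index r n).
Implicit Types (A B : {set 'I_n.+1}) (x : 'rV[R]_m).

Lemma density_eq0 x :
  (forall B, #|B| = k.+1 -> sum_wedge (coef lam omega x) B = 0) ->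
  density lam omega x = 0.
Proof.
by move=> H; apply: big1 => B /eqP Bk; rewrite H// normr0 expr0n mulr0.
Qed.

(** Wedging with complementary differentials and evaluating on the edges
    recovers the components. *)
Lemma sum_wedge_form_a (hk : (k <= n)%N) x :
  (forall u : 'I_k -> 'rV[R]_m, (forall i, tangent v (u i)) ->
    (\sum_(a in MI) \sum_(sigma in Sigma k n)
      smul (fun x => omega a sigma * lam_pow lam a x) (dlam lam sigma)) x u = 0) ->
  forall B, #|B| = k.+1 -> sum_wedge (coef lam omega x) B = 0.
Proof.
move=> H B Bk; suff : sgs C B (~: B) * sum_wedge (coef lam omega x) B = 0.
  move=> /(congr1 (fun y => sgs C B (~: B) * y)).
  by rewrite mulrA sgs_compl_sqr mul1r mulr0.
rewrite -(sum_wedge_dlam hk hlam _ x Bk).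
transitivity (wedge (\sum_(a in MI) \sum_(sigma in Sigma k n)
    smul (fun x => omega a sigma * lam_pow lam a x) (dlam lam sigma))
  (dlam lam (incr (n - k) (~: B))) x (fun i => edge v (cast_ord (subnKC hk) i))).
  rewrite wedge_suml; under [RHS]eq_bigr do rewrite wedge_suml big_Sigma.
  rewrite exchange_big; apply: eq_bigr => A _; rewrite /coef mulr_suml.
  by apply: eq_bigr => a _; rewrite wedge_smull.
by apply: wedge_eq0l => f; apply: H => i; exact: tangent_edge.
Qed.

(** The pointwise identity for the conjugate coefficients has the form of (b) as
    its second factor. *)
Lemma density_form_b (hk : (k <= n)%N) x :
  (forall u : 'I_(n - k) -> 'rV[R]_m, (forall i, tangent v (u i)) ->
    (\sum_(a in MI) \sum_(sigma in Sigma k n)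
      smul (fun x => eps C sigma (compl sigma) * omega a sigma *
                     lam_pow lam a x * lam_prod lam sigma x)
        (whitney lam (compl sigma))) x u = 0) ->
  density lam omega x = 0.
Proof.
move=> H; suff : (-1) ^+ k * density lam omega x = 0.
  by move/eqP; rewrite mulf_eq0 signr_eq0 => /eqP.
have := pointwise_identity hk hlam (fun A => (coef lam omega x A)^*) x.
under [in X in _ = X]eq_bigr do rewrite sum_wedge_conj norm_conjC.
rewrite -/(density lam omega x) => <-; apply: big1 => A /eqP Ak.
rewrite -mulr_sumr; apply/eqP; rewrite mulf_eq0; apply/orP; right; apply/eqP.
pose s := incr k A.
transitivity (wedge (dlam lam s) (\sum_(a in MI) \sum_(sigma in Sigma k n)
    smul (fun x => eps C sigma (compl sigma) * omega a sigma *
                   lam_pow lam a x * lam_prod lam sigma x)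
      (whitney lam (compl sigma))) x (fun i => edge v (cast_ord (subnKC hk) i))).
  rewrite wedge_sumr; under [RHS]eq_bigr do rewrite wedge_sumr big_Sigma.
  rewrite exchange_big; apply: eq_bigr => A' /eqP Ak'; rewrite conjCK /coef.
  rewrite mulr_sumr !mulr_suml; apply: eq_bigr => a _.
  rewrite wedge_smulr compl_incr// eps_incr ?(card_compl hk)// lam_prod_incr//.
  by rewrite -!mulrA.
by apply: wedge_eq0r => f; apply: H => i; exact: tangent_edge.
Qed.

Lemma ctame_density : ctame (fun t => density lam omega (param v t)).
Proof.
rewrite /density; apply: ctame_sum => B; apply: ctameM.
  under eq_fun do rewrite -rmorph_prod.
  by apply/ctame_real/tame_prod => i; exact: tame_lam.
have cS : ctame (fun t => sum_wedge (coef lam omega (param v t)) B).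
  under eq_fun do rewrite sum_wedge_coef; apply: ctame_sum => a.
  by apply: ctameM; [exact: ctame_lam_pow|exact: ctame_cst].
by under eq_fun do rewrite normCK; apply: ctameM => //; exact: ctame_conj.
Qed.

Lemma density_term_ge0 x (B : {set 'I_n.+1}) : simplex v x ->
  0 <= (\prod_(i in B) (lam i x)%:C%C) * `|sum_wedge (coef lam omega x) B| ^+ 2.
Proof.
move=> xT; apply: mulr_ge0; last by rewrite exprn_ge0.
by rewrite prodr_ge0// => i _; rewrite ler0c (lam_simplex_ge0 hlam).
Qed.

Lemma density_ge0 x : simplex v x -> 0 <= density lam omega x.
Proof. by move=> xT; apply: sumr_ge0 => B _; exact: density_term_ge0. Qed.

(** Where all barycentric coordinates are positive, a zero of the density is a
    zero of each component; these components are homogeneous polynomials. *)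
Lemma cintegral_density_eq0 :
  cintegral (fun t => density lam omega (param v t)) = 0 ->
  forall a (B : {set 'I_n.+1}), a \in MI -> #|B| = k.+1 -> wcoef omega a B = 0.
Proof.
move=> I0 a B aMI Bk; move: a aMI; apply: monomials_free => l l0 l1.
pose t : n.-tuple (measurableTypeR R) := [tuple l (lift ord0 j) | j < n].
have lE i : lam i (param v t) = l i.
  rewrite (lam_param hlam); case: (unliftP ord0 i) => [j|] ->/=.
    by rewrite tnth_mktuple.
  rewrite -l1 big_ord_recl; under [X in _ - X]eq_bigr do rewrite tnth_mktuple.
  by rewrite addrK.
have t0 j : 0 < (tnth t j : R) by rewrite tnth_mktuple.
have t1 : \sum_j tnth t j < 1 :> R.
  under eq_bigr do rewrite tnth_mktuple.
  by rewrite -l1 [X in _ < X]big_ord_recl ltrDr.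
have tD : std_simplex t by split=> [j|]; exact: ltW.
have := cintegral_eq0 ctame_density _ I0 t0 t1.
move=> /(_ (fun s Ds => density_ge0 (param_simplex v Ds))).
move=> /(psumr_eq0P (fun B' _ => density_term_ge0 B' (param_simplex v tD))).
move=> /(_ B (introT eqP Bk))/eqP; rewrite mulf_eq0 expf_eq0/= normr_eq0.
have /negPf -> : \prod_(i in B) (lam i (param v t))%:C%C != 0 :> C.
  by apply/prodf_neq0 => i _; rewrite lE gt_eqF// ltcR.
rewrite /= sum_wedge_coef => /eqP S0; rewrite -[RHS]S0; apply: eq_bigr => b _.
by rewrite /lam_pow; under [in RHS]eq_bigr do rewrite lE.
Qed.

End vanishing.

Theorem theorem6p5 (R : realType) (n r m k : nat) (hk : (k <= n)%N)
    (v : 'I_n.+1 -> 'rV[R]_m) (hv : affinely_independent v) (o : bool)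
    (lam : 'I_n.+1 -> 'rV[R]_m -> R) (hlam : barycentric v lam)
    (omega : {ffun 'I_n.+1 -> 'I_r.+1} -> {ffun 'I_k -> 'I_n.+1} -> R[i]) :
  let Q : R[i] :=
    \sum_(a in multi_index r n) \sum_(b in multi_index r n)
    \sum_(sigma in Sigma k n) \sum_(rho in Sigma k n)
      integral_form v o (cast_form (subnKC hk)
        (wedge
          (smul (fun x => omega a sigma * lam_pow lam a x) (dlam lam sigma))
          (smul (fun x => eps R[i] rho (compl rho) * (omega b rho)^* *
                          lam_pow lam b x * lam_prod lam rho x)
                (whitney lam (compl rho))))) in
  Q = (-1) ^+ k * \sum_(theta in Sigma k.+1 n)
        integral_form v o
          (smul (fun x => lam_prod lam theta x *
                   `|\sum_(a in multi_index r n) \sum_(p in im theta)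
                       eps1 R[i] p (del theta p) * lam_pow lam a x *
                       omega a (del theta p)| ^+ 2)
                (whitney lam (rhoT n)))
  /\ (Q = 0 <->
        vanishes v (\sum_(a in multi_index r n) \sum_(sigma in Sigma k n)
          smul (fun x => omega a sigma * lam_pow lam a x) (dlam lam sigma)))
  /\ (Q = 0 <->
        vanishes v (\sum_(a in multi_index r n) \sum_(sigma in Sigma k n)
          smul (fun x => eps R[i] sigma (compl sigma) * omega a sigma *
                         lam_pow lam a x * lam_prod lam sigma x)
               (whitney lam (compl sigma))))
  /\ (Q = 0 <->
        forall a sigma, a \in multi_index r n -> sigma \in Sigma k n ->
          ord0 \notin im sigma ->
          omega a sigma - \sum_(p in im sigma)
            eps1 R[i] p (del sigma p) * omega a (exch sigma p ord0) = 0)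
  /\ (Q = 0 <->
        forall a theta, a \in multi_index r n -> theta \in Sigma k.+1 n ->
          \sum_(p in im theta)
            eps1 R[i] p (del theta p) * omega a (del theta p) = 0).
Proof.
move=> Q; pose I := cintegral (fun t => density lam omega (param v t)).
have QI : Q = (-1) ^+ o * ((-1) ^+ k * I).
  rewrite -(cintegral_sign k (ctame_density hlam omega)).
  rewrite -(eq_cintegral (fun t _ => sum_integrand hk hlam omega (param v t))).
  have cF a b sigma rho : ctame (fun t => cast_form (subnKC hk) (wedge
      (smul (fun x => omega a sigma * lam_pow lam a x) (dlam lam sigma))
      (smul (fun x => eps R[i] rho (compl rho) * (omega b rho)^* *
                      lam_pow lam b x * lam_prod lam rho x)
         (whitney lam (compl rho)))) (param v t) (edge v)).
    under eq_fun do rewrite /cast_form wedge_smull wedge_smulr.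
    apply: ctameM; first by apply: ctameM; [exact: ctame_cst|exact: ctame_lam_pow].
    apply: ctameM; last exact: ctame_wedge_whitney.
    apply: ctameM; last exact: ctame_lam_prod.
    by apply: ctameM; [exact: ctame_cst|exact: ctame_lam_pow].
  rewrite cintegral_sum => [|a]; last by do 3 ! (apply: ctame_sum => ?).
  rewrite mulr_sumr; apply: eq_bigr => a _.
  rewrite cintegral_sum => [|b]; last by do 2 ! (apply: ctame_sum => ?).
  rewrite mulr_sumr; apply: eq_bigr => b _.
  rewrite cintegral_sum => [|sigma]; last by apply: ctame_sum.
  rewrite mulr_sumr; apply: eq_bigr => sigma _.
  rewrite cintegral_sum => [|rho]; last exact: cF.
  by rewrite mulr_sumr; apply: eq_bigr => rho _; rewrite integral_formE.
have Q0 : Q = 0 <-> I = 0.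
  rewrite QI; split=> [/eqP|->]; last by rewrite !mulr0.
  by rewrite !mulf_eq0 !signr_eq0 => /eqP.
have I0 : I = 0 <-> forall a (B : {set 'I_n.+1}), a \in multi_index r n ->
    #|B| = k.+1 -> wcoef omega a B = 0.
  split; first exact: cintegral_density_eq0.
  move=> H; rewrite /I -[RHS](cintegral0 R n); apply: eq_cintegral => t _.
  apply: density_eq0 => B Bk; rewrite sum_wedge_coef big1// => a aMI.
  by rewrite H ?mulr0.
have density0 : (forall x, simplex v x -> density lam omega x = 0) -> I = 0.
  move=> H; rewrite /I -[RHS](cintegral0 R n); apply: eq_cintegral => t tD.
  by rewrite H//; exact: param_simplex.
have S0 : I = 0 -> forall x (B : {set 'I_n.+1}), #|B| = k.+1 ->
    sum_wedge (coef lam omega x) B = 0.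
  move=> /I0 H x B Bk; rewrite sum_wedge_coef big1// => a aMI.
  by rewrite H ?mulr0.
split.
  rewrite QI mulrCA; congr (_ * _).
  under eq_bigr do rewrite integral_formE.
  rewrite -mulr_sumr -cintegral_sum; last first.
    move=> theta; apply: ctameM; last exact: ctame_whitney.
    apply: ctameM; first exact: ctame_lam_prod.
    under eq_fun do rewrite normCK.
    have cS : ctame (fun t => \sum_(a in multi_index r n) \sum_(p in im theta)
        eps1 R[i] p (del theta p) * lam_pow lam a (param v t) *
        omega a (del theta p)).
      do 2 ! (apply: ctame_sum => ?); apply: ctameM; last exact: ctame_cst.
      by apply: ctameM; [exact: ctame_cst|exact: ctame_lam_pow].
    by apply: ctameM => //; exact: ctame_conj.
  congr (_ * _); apply: eq_cintegral => t tD.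
  by rewrite -(sum_theta_integrand hlam omega (param_simplex v tD)).
split.
  rewrite Q0; split=> [/S0 H x xT u uT|H].
    rewrite form_aE (sum_dlam_border hlam)// big1// => B /eqP Bk.
    by rewrite H// mul0r.
  apply: density0 => x xT; apply: density_eq0.
  by apply: (sum_wedge_form_a hlam hk) => u uT; exact: H.
split.
  rewrite Q0; split=> [/S0 H x xT u uT|H].
    rewrite (form_bE hk hlam) big1 ?mulr0// => B /eqP Bk.
    by rewrite H// mulr0 mul0r.
  by apply: density0 => x xT; exact: density_form_b (H x xT).
split; first by rewrite Q0 I0 cond_c_wcoef.
by rewrite Q0 I0 cond_d_wcoef.
Qed.
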